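(* Let $m$ and $\nu$ be rational numbers with $m>0$, and let $q=e^{2\pi i\tau}$ with $\mathrm{Im}\,\tau>0$. Then the following three identities hold (the sums run over all nonnegative integers $i,j,k$): $$\sum_{i,j,k\geq 0} \frac{q^{2m(i-j)^2+(i+j)^2+2k^2-2(i+j)k+\nu(i-j)}}{(q^4;q^4)_i(q^4;q^4)_j(q^4;q^4)_k} =\frac{J_4^3\overline{J}_{2(4m+\nu+1),4(4m+1)}}{J_2^2J_8^2} +2q^{2m+\nu+1} \frac{J_8^2\overline{J}_{-2\nu,4(4m+1)}}{J_4^3},$$ $$\sum_{i,j,k\geq 0} \frac{q^{2m(i-j)^2+(i+j)^2+2k^2-2(i+j)k-2k}}{(q^4;q^4)_i(q^4;q^4)_j(q^4;q^4)_k} =4\frac{J_{8}^{2}\overline{J}_{8m,16m+4}}{J_{4}^{3}}+2q^{2m-1}\frac{J_{4}^{3}\overline{J}_{2,16m+4}}{J_{2}^{2}J_{8}^{2}},$$ $$\sum_{i,j,k\geq 0} \frac{q^{2m(i-j)^2+(i+j)^2+2k^2-2(i+j)k+i-j+2k}}{(q^4;q^4)_i(q^4;q^4)_j(q^4;q^4)_k}=\frac{J_8^2\overline{J}_{8m+2,16m+4}}{J_4^3}+q^{2m}\frac{J_4^3J_{32m+8}^2}{J_2^2J_8^2J_{16m+4}}.$$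
   Context: Notation: for $n\in\{0,1,2,\dots\}\cup\{\infty\}$, $(a;q)_n:=\prod_{k=0}^{n-1}(1-aq^k)$ and $(a_1,\dots,a_r;q)_n:=(a_1;q)_n\cdots(a_r;q)_n$. For rational $r$, $q^r$ means $e^{2\pi i r\tau}$. For rational $M>0$ and rational $a$, $J_M:=(q^M;q^M)_\infty$ and $\overline{J}_{a,M}:=(-q^a,-q^{M-a},q^M;q^M)_\infty$. *)

(* Defs.v *)
From HB Require Import structures.
From mathcomp Require Import all_boot all_order all_algebra finmap.
From mathcomp Require Import all_classical all_reals all_analysis.
From mathcomp Require Import complex showcase.summability.
Import Order.TTheory GRing.Theory Num.Theory.
Import numFieldNormedType.Exports.

Set Implicit Arguments.
Unset Strict Implicit.
Unset Printing Implicit Defensive.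

Local Open Scope classical_set_scope.
Local Open Scope ring_scope.

(* There are topologies on [K : numFieldType] and on [K^o], but none on the
   concrete type [R[i]]; this transfers the metric given by the modulus. *)
HB.instance Definition _ (R : rcfType) := NormedModule.copy R[i] R[i]^o.

Definition cexp (R : realType) (z : R[i]) : R[i] :=
  (expR (complex.Re z))%:C%C
  * (cos (complex.Im z) +i* sin (complex.Im z))%C.

(* q^r = e^(2 pi i r tau); in particular no choice of a branch is involved *)
Definition qpow (R : realType) (tau : R[i]) (r : rat) : R[i] :=
  cexp (2 * pi%:C%C * 'i%C * ratr r * tau).

Definition qpoch (R : realType) (a q : R[i]) (n : nat) : R[i] :=
  \prod_(k < n) (1 - a * q ^+ k).

(* Meaningful when the partial products converge, as they do for `|q| < 1. *)
Definition qpoch_oo (R : realType) (a q : R[i]) : R[i] :=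
  lim (qpoch a q n @[n --> \oo]).

Definition J (R : realType) (tau : R[i]) (M : rat) : R[i] :=
  qpoch_oo (qpow tau M) (qpow tau M).

Definition Jbar (R : realType) (tau : R[i]) (a M : rat) : R[i] :=
  qpoch_oo (- qpow tau a) (qpow tau M)
  * qpoch_oo (- qpow tau (M - a)) (qpow tau M)
  * qpoch_oo (qpow tau M) (qpow tau M).

(* The family f, indexed by all triples of natural numbers, has sum s: its
   finite partial sums converge to s along the directed set of finite sets of
   triples. For complex families this is absolute convergence with sum s. *)
Definition has_sum3 (R : realType) (f : nat -> nat -> nat -> R[i]) (s : R[i]) :
    Prop :=
  partial_sum (fun t : nat * nat * nat => f t.1.1 t.1.2 t.2) @ totally --> s.

(* Main.v *)
Require Import Defs.
From mathcomp Require Import all_boot all_order all_algebra finmap.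
From mathcomp Require Import all_classical all_reals all_analysis.
From mathcomp Require Import complex showcase.summability.
From mathcomp Require Import ring lra zify.
Import Order.TTheory GRing.Theory Num.Theory.
Import numFieldNormedType.Exports.

Set Implicit Arguments.
Unset Strict Implicit.
Unset Printing Implicit Defensive.

Local Open Scope classical_set_scope.
Local Open Scope fset_scope.
Local Open Scope ring_scope.

(** All three identities are instances of one reduction. Write Q for q^4 and
    let the exponent contain a linear term c k, so that c is 0, -2 and 2 in the
    three cases (with nu arbitrary, 0 and 1).

    The quadratic part of the exponent is a positive definite form in i, j, k,
    so that the triple series converges absolutely ([triple_term_has_sum]) and
    may be summed in any order. The sum over k is Euler's series for the product
    (- q^(2 + c - 2 (i + j)); Q)_oo. Fix next the difference n = i - j and sum
    over r = min (i, j): after the first factors of that product are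
    reflected ([qpoch_reflect]), this is Cauchy's series 1phi1, which also has a
    product as its sum. What remains is a sum over all integers n
    ([triple_sum_eq_single_sum]):

      1 / J_4 * sum_n q^((2 m + 1) n^2 + nu n)
                      (- q^(2 + c - 2 n), - q^(2 + c + 2 n); Q)_oo.

    For the three values of c the two products are, up to elementary factors,
    the theta product Jbar_(2 n, 4), after a shift of n when c = 0 and after
    adding the terms of n and - n when c = 2. As Jbar_(a, M) is quasi-periodic
    in a with period M ([JbarDz]), Jbar_(2 n, 4) is a power of q times
    Jbar_(0, 4) for even n and times Jbar_(2, 4) for odd n. Each parity class
    is therefore a theta series, which the Jacobi triple product evaluates
    ([theta_parity_sum]); this is where the two terms of each right-hand side
    come from.

    Euler's series, Cauchy's series and the Jacobi triple product are all limits
    of a single polynomial identity ([qbinomial_sum]), by Tannery's theorem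
    ([tannery]). *)

(** * Modulus and limits of complex numbers *)

(** The norm of [R[i]] takes complex values. Its real part makes bounds
    available to the order of the real numbers. *)
Definition cmod (R : realType) (z : R[i]) : R := complex.Re `|z|.

Section Modulus.
Variable R : realType.
Implicit Types z w : R[i].

Lemma normCE z : `|z| = (cmod z)%:C%C.
Proof. by rewrite /cmod RRe_real // normr_real. Qed.

Lemma cmod_ge0 z : 0 <= cmod z.
Proof. by rewrite -ler0c -normCE. Qed.

Lemma cmodD z w : cmod (z + w) <= cmod z + cmod w.
Proof. by rewrite -lecR rmorphD /= -!normCE ler_normD. Qed.

Lemma cmodM z w : cmod (z * w) = cmod z * cmod w.
Proof. by apply: complexI; rewrite rmorphM /= -!normCE normrM. Qed.

Lemma cmodN z : cmod (- z) = cmod z.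
Proof. by rewrite /cmod normrN. Qed.

Lemma cmodB z w : cmod (z - w) <= cmod z + cmod w.
Proof. by rewrite -[leRHS]/(_ + cmod w) -(cmodN w) cmodD. Qed.

Lemma cmodC z w : cmod (z - w) = cmod (w - z).
Proof. by rewrite -cmodN opprB. Qed.

Lemma cmod0 : cmod (0 : R[i]) = 0.
Proof. by rewrite /cmod normr0. Qed.

Lemma cmod1 : cmod (1 : R[i]) = 1.
Proof. by rewrite /cmod normr1. Qed.

Lemma cmod_eq0 z : (cmod z == 0) = (z == 0).
Proof. by rewrite -(inj_eq (@complexI R)) -normCE normr_eq0. Qed.

Lemma cmodV z : cmod z^-1 = (cmod z)^-1.
Proof. by apply: complexI; rewrite fmorphV /= -!normCE normfV. Qed.

Lemma cmodX z n : cmod (z ^+ n) = cmod z ^+ n.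
Proof. by apply: complexI; rewrite rmorphXn /= -!normCE normrX. Qed.

Lemma cmod_prod I (r : seq I) (P : pred I) (F : I -> R[i]) :
  cmod (\prod_(i <- r | P i) F i) = \prod_(i <- r | P i) cmod (F i).
Proof. exact: (big_morph _ cmodM cmod1). Qed.

Lemma cmod_sum I (r : seq I) (P : pred I) (F : I -> R[i]) :
  cmod (\sum_(i <- r | P i) F i) <= \sum_(i <- r | P i) cmod (F i).
Proof.
elim/big_ind2: _ => [|x a y b ha hb|//]; first by rewrite cmod0.
exact: le_trans (cmodD _ _) (lerD ha hb).
Qed.

Lemma cmod_le_Re_Im z : cmod z <= `|complex.Re z| + `|complex.Im z|.
Proof.
case: z => a b; rewrite /cmod normc_def /=.
rewrite -[leRHS]ger0_norm ?addr_ge0 // -sqrtr_sqr.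
apply: ler_wsqrtr; rewrite sqrrD !real_normK ?num_real // lerD2r lerDl.
by rewrite mulrn_wge0 // mulr_ge0.
Qed.

Lemma Re_le_cmod z : `|complex.Re z| <= cmod z.
Proof. by rewrite -lecR -normCE normc_ge_Re. Qed.

Lemma Im_le_cmod z : `|complex.Im z| <= cmod z.
Proof.
case: z => a b; rewrite /cmod normc_def /= -sqrtr_sqr.
by rewrite ler_wsqrtr // lerDr sqr_ge0.
Qed.

Lemma cmod_cvgP {T : Type} {F : set_system T} {FF : Filter F}
    (u : T -> R[i]) (l : R[i]) :
  u @ F --> l <->
  forall e : R, 0 < e -> \forall n \near F, cmod (l - u n) < e.
Proof.
split=> [/cvgrPdist_lt h e e0|h].
  have e0' : (0 : R[i]) < e%:C%C by rewrite ltcR.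
  by near=> n; rewrite -ltcR -normCE; near: n; apply: h.
apply/cvgrPdist_lt => e e0.
have eE : e = (complex.Re e)%:C%C by rewrite RRe_real // gtr0_real.
have e0' : 0 < complex.Re e by rewrite -ltcR -eE.
by near=> n; rewrite normCE eE ltcR; near: n; apply: h.
Unshelve. all: by end_near. Qed.

Lemma cvg_eq_lim (u v : nat -> R[i]) (k l : R[i]) :
  u n @[n --> \oo] --> k -> v n @[n --> \oo] --> l -> u =1 v -> k = l.
Proof.
move=> uk vl /funext uv; rewrite uv in uk; apply: cvg_unique uk vl.
exact: norm_hausdorff.
Qed.

Lemma cvg_double (u : nat -> R[i]) (l : R[i]) :
  u n @[n --> \oo] --> l -> u n.*2 @[n --> \oo] --> l.
Proof.
move=> ul; apply: cvg_comp ul => P [N _ hN]; exists N => // n /= Nn.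
by apply: hN => /=; rewrite -addnn; lia.
Qed.

Lemma cvg_absz_addz (u : nat -> R[i]) (l : R[i]) (j : int) :
  u n @[n --> \oo] --> l -> u `|(n%:Z + j)%R|%N @[n --> \oo] --> l.
Proof.
move=> ul; apply: cvg_comp ul => P [N _ hN]; exists (N + `|j|)%N => // n /= Nn.
by apply: hN => /=; lia.
Qed.

End Modulus.

(** * Unordered summation *)

#[local] Existing Instance totally_filter.

Definition has_sum (R : realType) (I : choiceType) (f : I -> R[i]) (s : R[i]) :=
  partial_sum f @ totally --> s.

(** For a family of nonnegative reals this is summability. It serves for the
    majorants of complex families. *)
Definition bounded_sums (R : realType) (I : choiceType) (g : I -> R) :=
  (forall i, 0 <= g i) /\ exists B, forall F : {fset I}, \sum_(i <- F) g i <= B.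

Section Summation.
Variable R : realType.

Lemma big_fsetSD (V : zmodType) (I : choiceType) (f : I -> V) (A B : {fset I}) :
  A `<=` B ->
  \sum_(i <- B) f i = \sum_(i <- A) f i + \sum_(i <- B `\` A) f i.
Proof.
move=> AB; rewrite (big_fsetID _ (mem A)) /=; congr (_ + _).
  apply: eq_fbigl => i; rewrite !inE /=; apply/andP/idP => [[]//|iA].
  by split=> //; apply: (fsubsetP AB).
by apply: eq_fbigl => i; rewrite !inE /= andbC.
Qed.

Lemma partial_sumE (V : zmodType) (I : choiceType) (f : I -> V) (A : {fset I}) :
  partial_sum f A = \sum_(i <- A) f i.
Proof. by rewrite /partial_sum big_seq_fsetE. Qed.

Lemma has_sumP (I : choiceType) (f : I -> R[i]) (s : R[i]) :
  has_sum f s <-> forall e : R, 0 < e -> exists F0 : {fset I},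
    forall F, F0 `<=` F -> cmod (s - \sum_(i <- F) f i) < e.
Proof.
split=> [/cmod_cvgP h e e0|h].
  have [F0 _ hF] := h e e0; exists F0 => F F0F.
  by rewrite -partial_sumE; apply: hF.
apply/cmod_cvgP => e e0; have [F0 hF] := h e e0.
by exists F0 => // F F0F; rewrite partial_sumE; apply: hF.
Qed.

Section Basic.
Variable I : choiceType.
Implicit Types (f : I -> R[i]) (g : I -> R) (A F : {fset I}).

Lemma has_sum_unique f s t : has_sum f s -> has_sum f t -> s = t.
Proof. by apply: cvg_unique; exact: norm_hausdorff. Qed.

Lemma eq_has_sum f f' s : f =1 f' -> has_sum f s -> has_sum f' s.
Proof. by move=> /funext ->. Qed.

Lemma has_sumZ (a : R[i]) f s :
  has_sum f s -> has_sum (fun i => a * f i) (a * s).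
Proof.
rewrite /has_sum => h.
have -> : partial_sum (fun i => a * f i) = (cst a \* partial_sum f).
  by apply/funext => F; rewrite /partial_sum /= mulr_sumr.
exact: (cvgM (cvg_cst a) h).
Qed.

Lemma has_sumD f f' s s' :
  has_sum f s -> has_sum f' s' -> has_sum (fun i => f i + f' i) (s + s').
Proof.
rewrite /has_sum => h h'.
have -> : partial_sum (fun i => f i + f' i) = partial_sum f \+ partial_sum f'.
  by apply/funext => F; rewrite /partial_sum /= big_split.
exact: (cvgD h h').
Qed.

Lemma has_sum_finite f A :
  (forall i, i \notin A -> f i = 0) -> has_sum f (\sum_(i <- A) f i).
Proof.
move=> f0; apply/has_sumP => e e0; exists A => F AF.
by rewrite (big_fset_incl _ AF) ?subrr ?cmod0 // => i _; apply: f0.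
Qed.

Lemma bounded_sumsZ (a : R) g :
  0 <= a -> bounded_sums g -> bounded_sums (fun i => a * g i).
Proof.
move=> a0 [g0 [B gB]]; split=> [i|]; first exact: mulr_ge0.
by exists (a * B) => F; rewrite -mulr_sumr ler_wpM2l.
Qed.

Lemma le_bounded_sums g g' : (forall i, 0 <= g' i <= g i) ->
  bounded_sums g -> bounded_sums g'.
Proof.
move=> g'g [g0 [B gB]]; split=> [i|]; first by case/andP: (g'g i).
exists B => F; apply: le_trans (gB F).
by apply: ler_sum => i _; case/andP: (g'g i).
Qed.

Lemma bounded_sums_cvg g : bounded_sums g ->
  exists s : R, forall e : R, 0 < e -> exists F0 : {fset I},
    forall F, F0 `<=` F -> s - e < \sum_(i <- F) g i <= s.
Proof.
move=> [g0 [B gB]].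
pose E := range (fun F : {fset I} => \sum_(i <- F) g i).
have supE : has_sup E.
  split; first by exists (\sum_(i <- fset0) g i); exists fset0.
  by exists B => _ [F _ <-].
exists (sup E) => e e0; have [_ [F0 _ <-] hF0] := sup_adherent e0 supE.
exists F0 => F F0F; apply/andP; split.
  by rewrite (big_fsetSD _ F0F) (lt_le_trans hF0) // lerDl sumr_ge0.
by apply: ub_le_sup; [case: supE|exists F].
Qed.

Lemma bounded_sums_tail g : bounded_sums g -> forall e : R, 0 < e ->
  exists F0 : {fset I}, forall F, F0 `<=` F -> \sum_(i <- F `\` F0) g i < e.
Proof.
move=> /bounded_sums_cvg [s hs] e e0; have [F0 hF0] := hs e e0.
exists F0 => F F0F; have /andP[_] := hF0 _ F0F; rewrite (big_fsetSD _ F0F).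
by have /andP[] := hF0 _ (fsubset_refl _); lra.
Qed.

(** The completeness of the real line enters here, through the suprema of the
    finite partial sums of [h + g] and of [g]. *)
Lemma dominated_real_sum g (h : I -> R) :
  bounded_sums g -> (forall i, `|h i| <= g i) ->
  exists s : R, forall e : R, 0 < e -> exists F0 : {fset I},
    forall F, F0 `<=` F -> `|s - \sum_(i <- F) h i| < e.
Proof.
move=> bg hg.
have bhg : bounded_sums (fun i => h i + g i).
  apply: (@le_bounded_sums (fun i => 2 * g i)); last exact: bounded_sumsZ.
  by move=> i; have := hg i; rewrite ler_norml => /andP[]; lra.
have [s1 hs1] := bounded_sums_cvg bhg; have [s2 hs2] := bounded_sums_cvg bg.
exists (s1 - s2) => e e0; have [F1 hF1] := hs1 e e0; have [F2 hF2] := hs2 e e0.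
exists (F1 `|` F2) => F; rewrite fsubUset => /andP[/hF1 h1 /hF2 h2].
by move: h1 h2; rewrite big_split /= ltr_norml => /andP[? ?] /andP[? ?]; lra.
Qed.

Lemma dominated_has_sum f g : bounded_sums g -> (forall i, cmod (f i) <= g i) ->
  exists s, has_sum f s.
Proof.
move=> bg fg.
have [|a ha] := @dominated_real_sum g (fun i => complex.Re (f i)) bg.
  by move=> i; exact: le_trans (Re_le_cmod _) _.
have [|b hb] := @dominated_real_sum g (fun i => complex.Im (f i)) bg.
  by move=> i; exact: le_trans (Im_le_cmod _) _.
exists (a +i* b)%C; apply/has_sumP => e e0.
have [|F1 h1] := ha (e / 2); first by lra.
have [|F2 h2] := hb (e / 2); first by lra.
exists (F1 `|` F2) => F; rewrite fsubUset => /andP[/h1 {}h1 /h2 {}h2].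
apply: le_lt_trans (cmod_le_Re_Im _) _.
have -> : \sum_(i <- F) f i =
    ((\sum_(i <- F) complex.Re (f i)) +i* (\sum_(i <- F) complex.Im (f i)))%C.
  elim: (F : seq I) => [|i r IH]; first by rewrite !big_nil.
  by rewrite !big_cons IH; case: (f i).
by rewrite /=; lra.
Qed.

(** A uniform bound on the remainder: it depends on the majorant [g] only, so
    that it holds for all members of a dominated sequence at once. *)
Lemma has_sum_tail f g s F0 (e : R) : has_sum f s ->
  (forall i, cmod (f i) <= g i) ->
  (forall F, F0 `<=` F -> \sum_(i <- F `\` F0) g i < e) ->
  forall F, F0 `<=` F -> cmod (s - \sum_(i <- F) f i) <= e.
Proof.
move=> /has_sumP hs fg tail F F0F; apply/ler_addgt0Pr => d d0.
have [F1 hF1] := hs d d0.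
have -> : s - \sum_(i <- F) f i = (s - \sum_(i <- F `|` F1) f i)
    + \sum_(i <- (F `|` F1) `\` F) f i.
  by rewrite (big_fsetSD _ (fsubsetUl F F1)) opprD addrA subrK.
apply: le_trans (cmodD _ _) _; rewrite [e + d]addrC; apply: lerD.
  exact/ltW/hF1/fsubsetUr.
apply: le_trans (cmod_sum _ _ _) _.
apply: le_trans (ler_sum _ (fun i _ => fg i)) _.
have F0F1 : F0 `<=` F `|` F1 by rewrite (fsubset_trans F0F) ?fsubsetUl.
have g0 i : 0 <= g i by exact: le_trans (cmod_ge0 _) (fg i).
apply/ltW; apply: le_lt_trans (tail _ F0F1).
rewrite [leRHS](big_fsetSD _ (fsetDS (F `|` F1) F0F)).
by rewrite lerDl sumr_ge0.
Qed.

(** Tannery's theorem. One finite set carries all of the families [u n] up to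
    a small error, and on that set the convergence is termwise. *)
Lemma tannery (u : nat -> I -> R[i]) f g (s : nat -> R[i]) l :
  bounded_sums g -> (forall n i, cmod (u n i) <= g i) ->
  (forall i, u n i @[n --> \oo] --> f i) ->
  (forall n, has_sum (u n) (s n)) -> s @ \oo --> l -> has_sum f l.
Proof.
move=> bg ug uf us sl; apply/has_sumP => e e0.
have e4 : 0 < e / 4 by lra.
have [F0 tail] := bounded_sums_tail bg e4.
exists F0 => F F0F.
have uFf : \sum_(i <- F) u n i @[n --> \oo] --> \sum_(i <- F) f i.
  by apply: cvg_big => [|i _]; [exact: add_continuous|exact: uf].
have /cmod_cvgP/(_ _ e4) h1 := uFf; have /cmod_cvgP/(_ _ e4) h2 := sl.
have [n [n1 n2]] : exists n, cmod (l - s n) < e / 4 /\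
    cmod (\sum_(i <- F) f i - \sum_(i <- F) u n i) < e / 4.
  have [n [? ?]] := filter_ex (filterI h1 h2).
  by exists n; split.
have n3 := has_sum_tail (us n) (ug n) tail F0F.
have -> : l - \sum_(i <- F) f i = (l - s n) + (s n - \sum_(i <- F) u n i)
   - (\sum_(i <- F) f i - \sum_(i <- F) u n i) by ring.
have := cmodB (l - s n + (s n - \sum_(i <- F) u n i))
  (\sum_(i <- F) f i - \sum_(i <- F) u n i).
have := cmodD (l - s n) (s n - \sum_(i <- F) u n i).
by lra.
Qed.

End Basic.
End Summation.

Section Rearrangement.
Variable R : realType.

Lemma big_fsetM (V : zmodType) (I J : choiceType) (A : {fset I}) (B : {fset J})
    (f : I * J -> V) :
  \sum_(t <- A `*` B) f t = \sum_(i <- A) \sum_(j <- B) f (i, j).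
Proof.
rewrite -big_allpairs; apply/perm_big/uniq_perm; first exact: fset_uniq.
  by apply: allpairs_uniq => // -[? ?] [? ?].
move=> [i j]; rewrite in_fsetM /=.
apply/andP/allpairsP => [[iA jB]|[[i' j'] [/= iA jB [-> ->]]]]; last by split.
by exists (i, j).
Qed.

Lemma has_sum_bij (I J : choiceType) (h : J -> I) (f : I -> R[i]) s :
  bijective h -> has_sum f s -> has_sum (fun j => f (h j)) s.
Proof.
move=> [k hK kK] /has_sumP hs; apply/has_sumP => e e0.
have [F0 hF0] := hs e e0; exists [fset k i | i in F0] => F F0F.
have <- : \sum_(i <- [fset h j | j in F]) f i = \sum_(j <- F) f (h j).
  by rewrite big_imfset //= => x y _ _; apply: (can_inj hK).
apply: hF0; apply/fsubsetP => i iF0; apply/imfsetP; exists (k i) => //=.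
by apply/(fsubsetP F0F)/in_imfset.
Qed.

Lemma has_sum_reindex (I J : choiceType) (h : J -> I) (f : I -> R[i]) s :
  bijective h -> has_sum (fun j => f (h j)) s -> has_sum f s.
Proof.
move=> [k hK kK] hs; apply: eq_has_sum (has_sum_bij (Bijective kK hK) hs) => i.
by rewrite kK.
Qed.

(** This serves to sum a series over its even and its odd indices apart. *)
Lemma has_sum_pair_bool (I : choiceType) (f : bool * I -> R[i]) a b :
  has_sum (fun i => f (false, i)) a -> has_sum (fun i => f (true, i)) b ->
  has_sum f (a + b).
Proof.
move=> /has_sumP ha /has_sumP hb; apply/has_sumP => e e0.
have e2 : 0 < e / 2 by lra.
have [A hA] := ha _ e2; have [B hB] := hb _ e2.
exists ([fset (false, i) | i in A] `|` [fset (true, i) | i in B]) => F.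
rewrite fsubUset => /andP[/fsubsetP FA /fsubsetP FB].
pose slice c := [fset t.2 | t in [fset t in F | t.1 == c]].
have sliceE c : \sum_(t <- [fset t in F | t.1 == c]) f t
    = \sum_(i <- slice c) f (c, i).
  rewrite /slice [RHS]big_imfset /=; last first.
    move=> [c1 i] [c2 j]; rewrite !inE /= => /andP[_ /eqP ->] /andP[_ /eqP ->].
    by move=> ->.
  apply: eq_big_seq => t /imfsetP[u /=]; rewrite inE => /andP[_ /eqP <-] ->.
  by case: u.
have split : \sum_(t <- F) f t =
    \sum_(i <- slice false) f (false, i) + \sum_(i <- slice true) f (true, i).
  rewrite -!sliceE (big_fsetID _ (fun t : bool * I => t.1 == false)) /=.
  by congr (_ + _); apply: eq_fbigl => -[[] i]; rewrite !inE.
have mem_slice c i : (c, i) \in F -> i \in slice c.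
  by move=> tF; apply/imfsetP; exists (c, i) => //; rewrite !inE tF /=.
have hA' : A `<=` slice false.
  by apply/fsubsetP => i iA; apply/mem_slice/FA/in_imfset.
have hB' : B `<=` slice true.
  by apply/fsubsetP => i iB; apply/mem_slice/FB/in_imfset.
rewrite split opprD addrACA; apply: le_lt_trans (cmodD _ _) _.
by have := hA _ hA'; have := hB _ hB'; lra.
Qed.

(** Summation by rows. For a fixed finite set [A] of rows the sums over
    [A `*` B] tend to the sum of [g] over [A] as [B] grows, and they are close
    to [s] as soon as [A] and [B] are large. *)
Lemma has_sum_iterated (I J : choiceType) (f : I * J -> R[i]) (g : I -> R[i])
    s :
  has_sum f s -> (forall i, has_sum (fun j => f (i, j)) (g i)) -> has_sum g s.
Proof.
move=> /has_sumP hs fg; apply/has_sumP => e e0.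
have e2 : 0 < e / 2 by lra.
have [F0 hF0] := hs _ e2; exists [fset t.1 | t in F0] => A F0A.
have /cmod_cvgP/(_ _ e2) hA :
    partial_sum (fun j => \sum_(i <- A) f (i, j)) @ totally
      --> \sum_(i <- A) g i.
  have -> : partial_sum (fun j => \sum_(i <- A) f (i, j)) =
      (fun B => \sum_(i <- A) partial_sum (fun j => f (i, j)) B).
    by apply/funext => B; rewrite /partial_sum exchange_big.
  by apply: cvg_big => [|i _]; [exact: add_continuous|exact: fg].
have hB : totally [set B | [fset t.2 | t in F0] `<=` B].
  by exists [fset t.2 | t in F0].
have [B /= [h1 F0B]] := filter_ex (filterI hA hB).
have F0AB : F0 `<=` A `*` B.
  apply/fsubsetP => t tF0; rewrite in_fsetM; apply/andP; split.
    exact/(fsubsetP F0A)/in_imfset.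
  exact/(fsubsetP F0B)/in_imfset.
have := hF0 _ F0AB; rewrite big_fsetM exchange_big /= => h2.
move: h1; rewrite partial_sumE cmodC => h1.
set X := \sum_(j <- B) _ in h1 h2.
have -> : s - \sum_(i <- A) g i = (s - X) + (X - \sum_(i <- A) g i) by ring.
by apply: le_lt_trans (cmodD _ _) _; lra.
Qed.

Lemma big_fset_iota (V : zmodType) (f : nat -> V) n :
  \sum_(k <- [fset k in iota 0 n]) f k = \sum_(k < n) f k.
Proof.
rewrite -(big_mkord xpredT f) /index_iota subn0.
apply/perm_big/uniq_perm; rewrite ?fset_uniq ?iota_uniq // => k.
by rewrite in_fset.
Qed.

Lemma has_sum_nat_partial (f : nat -> R[i]) s : has_sum f s ->
  \sum_(k < n) f k @[n --> \oo] --> s.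
Proof.
move=> /has_sumP hs; apply/cmod_cvgP => e e0; have [F0 hF0] := hs e e0.
exists (\max_(k <- F0) k.+1)%N => // n /= nF0.
rewrite -big_fset_iota; apply: hF0; apply/fsubsetP => k kF0.
rewrite !inE mem_iota /= add0n.
apply: leq_trans nF0; by apply: (leq_bigmax_seq k (F := fun k => k.+1)).
Qed.

Lemma bounded_sums_inj (I J : choiceType) (h : J -> I) (g : I -> R) :
  injective h -> bounded_sums g -> bounded_sums (fun j => g (h j)).
Proof.
move=> hI [g0 [B gB]]; split=> // ; exists B => F.
have <- : \sum_(i <- [fset h j | j in F]) g i = \sum_(j <- F) g (h j).
  by rewrite big_imfset //= => x y _ _; apply: hI.
exact: gB.
Qed.

Lemma bounded_sumsM (I J : choiceType) (g : I -> R) (h : J -> R) :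
  bounded_sums g -> bounded_sums h -> bounded_sums (fun t => g t.1 * h t.2).
Proof.
move=> [g0 [B gB]] [h0 [C hC]]; split=> [t|]; first exact: mulr_ge0.
have B0 : 0 <= B by apply: le_trans (gB fset0); rewrite sumr_ge0.
have gh0 t : 0 <= g t.1 * h t.2 by exact: mulr_ge0.
exists (B * C) => F.
pose F1 := [fset t.1 | t in F]; pose F2 := [fset t.2 | t in F].
have FF : F `<=` F1 `*` F2.
  by apply/fsubsetP => t tF; rewrite in_fsetM !in_imfset.
apply: (@le_trans _ _ (\sum_(t <- F1 `*` F2) g t.1 * h t.2)).
  by rewrite (big_fsetSD _ FF) lerDl sumr_ge0.
rewrite big_fsetM /=; under eq_bigr do rewrite -mulr_sumr.
rewrite -mulr_suml.
by apply: ler_pM; rewrite ?sumr_ge0.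
Qed.

Lemma bounded_sums_finite (I : finType) (g : I -> R) :
  (forall i, 0 <= g i) -> bounded_sums g.
Proof.
move=> g0; split=> //; exists (\sum_(i <- [fset i in I]) g i) => F.
have FI : F `<=` [fset i in I] by apply/fsubsetP => i; rewrite !inE.
by rewrite (big_fsetSD _ FI) lerDl sumr_ge0.
Qed.

Lemma bounded_sums_geometric (y : R) : 0 <= y < 1 ->
  bounded_sums (fun n : nat => y ^+ n).
Proof.
move=> /andP[y0 y1]; split=> [n|]; first exact: exprn_ge0.
have geo n : (1 - y) * \sum_(k < n) y ^+ k <= 1.
  by rewrite -opprB mulNr -subrX1 opprB gerBl exprn_ge0.
exists (1 - y)^-1 => F; pose N := (\max_(k <- F) k.+1)%N.
have FN : F `<=` [fset k in iota 0 N].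
  apply/fsubsetP => k kF; rewrite !inE mem_iota /= add0n.
  by apply: (leq_bigmax_seq k (F := fun k => k.+1)).
apply: (@le_trans _ _ (\sum_(k <- [fset k in iota 0 N]) y ^+ k)).
  by rewrite (big_fsetSD _ FN) lerDl sumr_ge0 // => k _; rewrite exprn_ge0.
by rewrite big_fset_iota -[leRHS]mul1r ler_pdivlMr ?subr_gt0 // mulrC.
Qed.

Lemma bounded_sums_geometric_int (y : R) : 0 <= y < 1 ->
  bounded_sums (fun n : int => y ^+ `|n|%N).
Proof.
move=> y01; pose h (n : int) := (0 <= n, `|n|%N).
have hI : injective h by move=> m n []; lia.
apply: (@le_bounded_sums _ _ (fun n => 1 * y ^+ (h n).2)).
  by move=> n; rewrite mul1r /h /= lexx exprn_ge0 //; case/andP: y01.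
apply: (bounded_sums_inj hI (g := fun t : bool * nat => 1 * y ^+ t.2)).
apply: (bounded_sumsM (g := fun=> 1)); last exact: bounded_sums_geometric.
exact: bounded_sums_finite.
Qed.

End Rearrangement.

(** * Finite q-Pochhammer products *)

Section FiniteProducts.
Variable R : realType.
Implicit Types a q x : R[i].

Lemma qpoch0 a q : qpoch a q 0 = 1.
Proof. by rewrite /qpoch big_ord0. Qed.

Lemma qpoch0l q n : qpoch 0 q n = 1.
Proof. by rewrite /qpoch big1 // => k _; rewrite mul0r subr0. Qed.

Lemma qpochSr a q n : qpoch a q n.+1 = qpoch a q n * (1 - a * q ^+ n).
Proof. by rewrite /qpoch big_ord_recr. Qed.

Lemma qpochSl a q n : qpoch a q n.+1 = (1 - a) * qpoch (a * q) q n.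
Proof.
rewrite /qpoch big_ord_recl expr0 mulr1; congr (_ * _).
by apply: eq_bigr => k _; rewrite /bump /= ?add1n exprS mulrA.
Qed.

Lemma qpochD a q m n : qpoch a q (m + n) = qpoch a q m * qpoch (a * q ^+ m) q n.
Proof.
elim: n => [|n IH]; first by rewrite addn0 qpoch0 mulr1.
by rewrite addnS !qpochSr IH exprD !mulrA.
Qed.

(** The Gaussian binomial coefficient. Pascal's rule defines it for every [q],
    whereas the quotient of products needs [q] not to be a root of unity. *)
Fixpoint qbin q (n k : nat) : R[i] :=
  match n, k with
  | _, 0 => 1
  | 0, _.+1 => 0
  | n'.+1, k'.+1 => q ^+ k'.+1 * qbin q n' k'.+1 + qbin q n' k'
  end.

Lemma qbin_small q n k : (n < k)%N -> qbin q n k = 0.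
Proof.
elim: n k => [|n IH] [|k] //= nk.
by rewrite !IH ?mulr0 ?addr0 //; lia.
Qed.

Lemma qbin_qpoch q n k : (k <= n)%N ->
  qbin q n k * (qpoch q q k * qpoch q q (n - k)) = qpoch q q n.
Proof.
elim: n k => [|n IH] [|k] //= kn; rewrite ?qpoch0 ?mul1r ?subn0 //.
have := IH k; rewrite subSS => /(_ kn) IHk; rewrite mulrDl.
have -> : qbin q n k * (qpoch q q k.+1 * qpoch q q (n - k)) =
    (1 - q ^+ k.+1) * qpoch q q n.
  by rewrite -IHk qpochSr -exprS; ring.
have [kn'|nk] := ltnP k n; last first.
  have -> : k = n by lia.
  by rewrite qbin_small // mulr0 mul0r add0r qpochSr -exprS mulrC.
have <- : (n - k.+1).+1 = (n - k)%N by lia.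
have -> : q ^+ k.+1 * qbin q n k.+1 * (qpoch q q k.+1 * qpoch q q (n - k.+1).+1)
   = q ^+ k.+1 * (1 - q ^+ (n - k.+1).+1) * qpoch q q n.
  by rewrite -(IH _ kn') (qpochSr _ _ (n - k.+1)) -exprS; ring.
rewrite mulrBr mulr1 -exprD qpochSr -exprS.
have -> : (k.+1 + (n - k.+1).+1)%N = n.+1 by lia.
by ring.
Qed.

(** The q-Chu-Vandermonde sum with its denominators cleared. Pascal's rule turns
    each term of order [n + 1] into [1 - x] times the term of order [n] at
    [x q], by
      (1 - a x q^r) - x (1 - a q^r) = 1 - x,
    and the right-hand side satisfies the same recurrence. The case [a = 0] is
    the q-binomial theorem. *)
Lemma qbinomial_sum q a x n :
  \sum_(r < n.+1) qbin q n r * (q ^+ 'C(r, 2) * (- x) ^+ r * qpoch a q r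
     * qpoch (a * x * q ^+ r) q (n - r)) = qpoch x q n.
Proof.
elim: n x => [|n IH] x.
  by rewrite big_ord_recl big_ord0 /= !qpoch0 !expr0 !mulr1 addr0.
pose W r := q ^+ 'C(r, 2) * (- x) ^+ r * qpoch a q r
     * qpoch (a * x * q ^+ r) q (n.+1 - r).
rewrite -[LHS]/(\sum_(r < n.+2) qbin q n.+1 r * W r).
have -> : \sum_(r < n.+2) qbin q n.+1 r * W r =
   \sum_(r < n.+1) qbin q n r * (q ^+ r * W r + W r.+1).
  rewrite big_ord_recl /=.
  under eq_bigr do rewrite /bump /= ?add1n mulrDl.
  rewrite big_split /= addrA.
  have -> : 1 * W 0%N + \sum_(i < n.+1) q ^+ i.+1 * qbin q n i.+1 * W i.+1 =
      \sum_(i < n.+2) q ^+ i * qbin q n i * W i.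
    by rewrite [RHS]big_ord_recl /= expr0; case: (n) => [|?]; rewrite /= mulr1.
  rewrite big_ord_recr /= qbin_small // mulr0 mul0r addr0 -big_split /=.
  by apply: eq_bigr => i _; ring.
rewrite qpochSl -IH mulr_sumr; apply: eq_bigr => -[r /= rn] _.
rewrite /W; have -> : (n.+1 - r = (n - r).+1)%N by lia.
rewrite subSS qpochSl (qpochSr _ _ r) binS bin1 exprD (exprS _ r) (exprS _ r).
have -> : a * x * q ^+ r * q = a * (x * q) * q ^+ r by ring.
have -> : a * x * (q * q ^+ r) = a * (x * q) * q ^+ r by ring.
by rewrite -[- (x * q)]mulNr exprMn; ring.
Qed.

End FiniteProducts.

(** * Infinite q-Pochhammer products *)

Section InfiniteProducts.
Variables (R : realType) (q : R[i]).
Hypothesis q1 : cmod q < 1.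
Let y := cmod q.
Let y0 : 0 <= y. Proof. exact: cmod_ge0. Qed.
Let y1 : 0 < 1 - y. Proof. by rewrite subr_gt0. Qed.
Implicit Types a x : R[i].

Lemma prod_expR_geometric (c : R) (F : nat -> R) n : 0 <= c ->
  (forall k, 0 <= F k <= expR (c * y ^+ k)) ->
  \prod_(k < n) F k <= expR (c / (1 - y)).
Proof.
move=> c0 hF; apply: (@le_trans _ _ (\prod_(k < n) expR (c * y ^+ k))).
  by apply: ler_prod => i _; exact: hF.
rewrite -expR_sum ler_expR -mulr_sumr ler_wpM2l //.
rewrite -[leRHS]mul1r ler_pdivlMr // mulrC -opprB mulNr -subrX1 opprB.
by rewrite gerBl exprn_ge0.
Qed.

Lemma cmod_qpoch_le a n : cmod (qpoch a q n) <= expR (cmod a / (1 - y)).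
Proof.
rewrite cmod_prod.
apply: (prod_expR_geometric (F := fun k => cmod (1 - a * q ^+ k))) => [|k].
  exact: cmod_ge0.
rewrite cmod_ge0 /=; apply: le_trans (cmodB _ _) _.
by rewrite cmod1 cmodM cmodX expR_ge1Dx.
Qed.

(** With t = y^(k + 1), one has 1 / (1 - t) = 1 + t / (1 - t), which is at most
    the exponential of y^k / (1 - y). *)
Lemma cmod_qpoch_inv_le n :
  (cmod (qpoch q q n))^-1 <= expR ((1 - y)^-1 / (1 - y)).
Proof.
rewrite cmod_prod -prodfV.
apply: (prod_expR_geometric
  (F := fun k => (cmod (1 - q * q ^+ k))^-1)) => [|k].
  by rewrite invr_ge0 ltW.
rewrite invr_ge0 cmod_ge0 /=; apply: le_trans (expR_ge1Dx _).
have yk0 : 0 <= y ^+ k by exact: exprn_ge0.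
have yk1 : y ^+ k <= 1 by rewrite exprn_ile1 // ltW.
have h : 1 - y * y ^+ k <= cmod (1 - q * q ^+ k).
  have := cmodD (1 - q * q ^+ k) (q * q ^+ k).
  by rewrite subrK cmod1 cmodM cmodX -/y; lra.
have yyk : y * y ^+ k <= y by rewrite ler_piMr.
have p : 0 < 1 - y * y ^+ k by move: y1; lra.
apply: le_trans (_ : (1 - y * y ^+ k)^-1 <= _).
  by rewrite lef_pV2 // posrE // (lt_le_trans p).
rewrite -[leLHS]mul1r ler_pdivrMr //.
have B1 : 1 <= (1 - y)^-1 * (1 - y * y ^+ k).
  by rewrite mulrC ler_pdivlMr // mul1r; lra.
by move: y0 y1 => ? ?; nra.
Qed.

Lemma qpoch_neq0 n : qpoch q q n != 0.
Proof.
apply/prodf_neq0 => k _; rewrite subr_eq0; apply/eqP => /(congr1 (@cmod R)).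
rewrite cmod1 cmodM cmodX -/y => h1.
have : y ^+ k <= 1 by rewrite exprn_ile1 // ltW.
by move: y0 y1 => ? ? ?; nra.
Qed.

(** Consecutive partial products differ by a geometrically small amount, so
    that the product is a telescoping absolutely convergent series. *)
Lemma qpoch_cvg a : qpoch a q n @[n --> \oo] --> qpoch_oo a q.
Proof.
have telescope n : qpoch a q n = 1 - \sum_(k < n) qpoch a q k * (a * q ^+ k).
  elim: n => [|n IH]; first by rewrite qpoch0 big_ord0 subr0.
  by rewrite qpochSr big_ord_recr /= opprD addrA -IH mulrBr mulr1.
have [|k|s hs] := @dominated_has_sum R _ (fun k => qpoch a q k * (a * q ^+ k))
    (fun k => expR (cmod a / (1 - y)) * cmod a * y ^+ k).
- apply: bounded_sumsZ; first by rewrite mulr_ge0 ?expR_ge0 ?cmod_ge0.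
  by apply: bounded_sums_geometric; rewrite y0.
- rewrite !cmodM cmodX -mulrA; apply: ler_wpM2r; last exact: cmod_qpoch_le.
  by rewrite mulr_ge0 ?exprn_ge0 ?cmod_ge0.
have lim1s : qpoch a q n @[n --> \oo] --> 1 - s.
  rewrite (funext telescope).
  exact: (cvgB (cvg_cst _) (has_sum_nat_partial hs)).
rewrite /qpoch_oo (_ : lim _ = 1 - s) //.
by apply: cvg_lim lim1s; exact: norm_hausdorff.
Qed.

Lemma qpoch_oo_shift a n : qpoch_oo a q = qpoch a q n * qpoch_oo (a * q ^+ n) q.
Proof.
have h : qpoch a q (k + n)%N @[k --> \oo] --> qpoch_oo a q.
  by have := @qpoch_cvg a; rewrite -(cvg_shiftn n).
apply: (cvg_eq_lim h
  (cvgM (cvg_cst (qpoch a q n)) (@qpoch_cvg (a * q ^+ n)))) => k.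
by rewrite addnC qpochD.
Qed.

Lemma qpoch_oo0l : qpoch_oo 0 q = 1.
Proof.
have lim1 : (1 : R[i]) @[_ --> \oo] --> (1 : R[i]) by exact: cvg_cst.
by apply: (cvg_eq_lim (@qpoch_cvg 0) lim1) => n; exact: qpoch0l.
Qed.

(** An infinite product of nonzero factors could vanish; the uniform bound on
    the inverses of the partial products excludes it. *)
Lemma qpoch_oo_neq0 : qpoch_oo q q != 0.
Proof.
apply/eqP => h0; have := @qpoch_cvg q; rewrite h0.
have B0 : 0 < (expR ((1 - y)^-1 / (1 - y)))^-1 by rewrite invr_gt0 expR_gt0.
move=> /cmod_cvgP/(_ _ B0)/filter_ex[n].
rewrite sub0r cmodN ltNge => /negP; apply.
rewrite -[leRHS]invrK lef_pV2 ?cmod_qpoch_inv_le // posrE ?expR_gt0 //.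
by rewrite invr_gt0 lt_neqAle cmod_ge0 eq_sym cmod_eq0 qpoch_neq0.
Qed.

End InfiniteProducts.

Section InfiniteProductIdentities.
Variable R : realType.
Implicit Types a q : R[i].

Lemma cmod_sqr_lt1 q : cmod q < 1 -> cmod (q ^+ 2) < 1.
Proof. by move=> q1; rewrite cmodX exprn_ilt1 // cmod_ge0. Qed.

Lemma qpoch_oo_dup a q : cmod q < 1 ->
  qpoch_oo a q * qpoch_oo (- a) q = qpoch_oo (a ^+ 2) (q ^+ 2).
Proof.
move=> q1.
apply: cvg_eq_lim (cvgM (@qpoch_cvg _ _ q1 a) (@qpoch_cvg _ _ q1 (- a)))
  (@qpoch_cvg _ _ (cmod_sqr_lt1 q1) _) _ => n.
rewrite /= /qpoch -big_split /=; apply: eq_bigr => k _.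
by rewrite -exprM mulnC exprM; ring.
Qed.

Lemma qpoch_oo_split a q : cmod q < 1 ->
  qpoch_oo a q = qpoch_oo a (q ^+ 2) * qpoch_oo (a * q) (q ^+ 2).
Proof.
move=> q1; have q2 := cmod_sqr_lt1 q1.
apply: cvg_eq_lim (cvg_double (@qpoch_cvg _ _ q1 a))
  (cvgM (@qpoch_cvg _ _ q2 a) (@qpoch_cvg _ _ q2 (a * q))) _ => n /=.
elim: n => [|n IH]; first by rewrite !qpoch0 mulr1.
rewrite doubleS !qpochSr IH -exprM mul2n (exprS q n.*2).
by move: (q ^+ n.*2) => z; ring.
Qed.

End InfiniteProductIdentities.

(** * Euler's and Cauchy's series *)

Section OnePhiOne.
Variables (R : realType) (q : R[i]).
Hypothesis q1 : cmod q < 1.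
Implicit Types a x : R[i].

Lemma qbinE n k : (k <= n)%N ->
  qbin q n k = qpoch q q n / (qpoch q q k * qpoch q q (n - k)).
Proof.
by move=> kn; rewrite -(qbin_qpoch q kn) mulfK // mulf_neq0 ?qpoch_neq0.
Qed.

Lemma cmod_qbin_le : exists2 C : R, 0 <= C & forall n k, cmod (qbin q n k) <= C.
Proof.
set y := cmod q; set B := expR ((1 - y)^-1 / (1 - y)).
exists (expR (y / (1 - y)) * (B * B)); first by rewrite !mulr_ge0 ?expR_ge0.
move=> n k; have [kn|nk] := leqP k n; last first.
  by rewrite qbin_small // cmod0 !mulr_ge0 ?expR_ge0.
rewrite qbinE // cmodM cmodV cmodM invfM.
by rewrite !ler_pM ?mulr_ge0 ?invr_ge0 ?cmod_ge0 ?cmod_qpoch_le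
  ?cmod_qpoch_inv_le.
Qed.

Lemma qbin_cvg r : qbin q n r @[n --> \oo] --> (qpoch q q r)^-1.
Proof.
have q0 := qpoch_oo_neq0 q1; rewrite -(cvg_shiftn r) /=.
have -> : (qpoch q q r)^-1 = qpoch_oo q q / (qpoch q q r * qpoch_oo q q).
  by rewrite invfM mulrCA divff // mulr1.
under eq_fun do rewrite qbinE ?leq_addl // addnK.
have h := @qpoch_cvg _ _ q1 q; apply: (cvgM _ (cvgV _ (cvgM (cvg_cst _) h))).
  by move: h; rewrite -(cvg_shiftn r).
by rewrite mulf_neq0 ?qpoch_neq0.
Qed.

Lemma bounded_sums_ratio (g : nat -> R) N : (forall n, 0 <= g n) ->
  (forall n, (N <= n)%N -> g n.+1 <= g n / 2) -> bounded_sums g.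
Proof.
move=> g0 gN; pose K := \sum_(k < N.+1) g k * 2 ^+ k.
have K0 : 0 <= K by rewrite sumr_ge0 // => k _; rewrite mulr_ge0 ?exprn_ge0.
have g2 n : g n * 2 ^+ n <= K.
  elim: n => [|n IH]; rewrite ?exprS.
    rewrite /K big_ord_recl lerDl sumr_ge0 // => k _.
    by rewrite mulr_ge0 ?exprn_ge0.
  have [nN|Nn] := ltnP n N; last first.
    apply: le_trans IH; have gn := gN _ Nn.
    by rewrite mulrA ler_wpM2r ?exprn_ge0 //; lra.
  rewrite /K -exprS (bigD1 (Ordinal (nN : (n.+1 < N.+1)%N))) //=.
  by rewrite lerDl sumr_ge0 // => k _; rewrite mulr_ge0 ?exprn_ge0.
apply: (@le_bounded_sums _ _ (fun n => K * 2^-1 ^+ n)).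
  by move=> n; rewrite g0 exprVn ler_pdivlMr ?exprn_gt0 ?g2.
by apply: bounded_sumsZ K0 (bounded_sums_geometric _); lra.
Qed.

Lemma bounded_sums_qpow_bin (X y : R) : 0 <= X -> 0 <= y < 1 ->
  bounded_sums (fun r : nat => y ^+ 'C(r, 2) * X ^+ r).
Proof.
move=> X0 /andP[y0 y1].
have : (fun n => y ^+ n) @ \oo --> (0 : R).
  by apply: cvg_expr; rewrite ger0_norm.
have d0 : 0 < (2 * (X + 1))^-1 by rewrite invr_gt0; lra.
move=> /cvgrPdist_lt/(_ _ d0)[N _ hN].
apply: (@bounded_sums_ratio _ N) => [n|n Nn].
  by rewrite mulr_ge0 ?exprn_ge0.
rewrite binS bin1 exprD exprS -!mulrA ler_wpM2l ?exprn_ge0 //.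
rewrite mulrA [leRHS]mulrC ler_wpM2r ?exprn_ge0 //.
have := hN n Nn; rewrite /= sub0r normrN ger0_norm ?exprn_ge0 // => /ltW yn.
apply: le_trans (ler_wpM2r X0 yn) _.
by rewrite invfM -mulrA ler_piMr // mulrC ler_pdivrMr; lra.
Qed.

(** Letting [n] go to infinity in the finite sum gives Cauchy's summation of
    the series 1phi1, with lower parameter [a x]: its usual
    denominators (a x; q)_r are absorbed in the factors (a x q^r; q)_oo, so
    that there is nothing to exclude. *)
Lemma one_phi_one a x :
  has_sum (fun r : nat => (qpoch q q r)^-1 * (q ^+ 'C(r, 2) * (- x) ^+ r
     * qpoch a q r * qpoch_oo (a * x * q ^+ r) q)) (qpoch_oo x q).
Proof.
have [C C0 hC] := cmod_qbin_le; set y := cmod q.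
have yb : 0 <= y < 1 by rewrite cmod_ge0.
have d0 : 0 < 1 - y by rewrite subr_gt0.
pose u n r := if (r <= n)%N then qbin q n r * (q ^+ 'C(r, 2) * (- x) ^+ r
     * qpoch a q r * qpoch (a * x * q ^+ r) q (n - r)) else 0.
pose M := C * (expR (cmod a / (1 - y)) * expR (cmod (a * x) / (1 - y))).
have M0 : 0 <= M by rewrite !mulr_ge0 ?expR_ge0.
have bg := bounded_sumsZ M0 (bounded_sums_qpow_bin (cmod_ge0 x) yb).
apply: (tannery (u := u) bg _ _ _ (@qpoch_cvg _ _ q1 x)) => [n r|r|n].
- rewrite /u; case: ifP => _; last first.
    by rewrite cmod0 !mulr_ge0 ?expR_ge0 ?exprn_ge0 ?cmod_ge0.
  rewrite !cmodM !cmodX cmodN.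
  have h1 := cmod_qpoch_le q1 a r.
  have h2 : cmod (qpoch (a * x * q ^+ r) q (n - r)) <=
      expR (cmod (a * x) / (1 - y)).
    apply: le_trans (cmod_qpoch_le q1 _ _) _.
    rewrite ler_expR ler_wpM2r ?invr_ge0 ?(ltW d0) // cmodM cmodX.
    by rewrite ler_piMr ?cmod_ge0 // exprn_ile1 ?cmod_ge0 // ltW.
  have -> : M * (y ^+ 'C(r, 2) * cmod x ^+ r) = C * (y ^+ 'C(r, 2) * cmod x ^+ r
      * expR (cmod a / (1 - y)) * expR (cmod (a * x) / (1 - y))).
    by rewrite /M; ring.
  by rewrite !ler_pM ?mulr_ge0 ?exprn_ge0 ?cmod_ge0 ?hC.
- rewrite -(cvg_shiftn r) /= /u.
  under eq_fun do rewrite leq_addl addnK.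
  have h : qbin q (n + r)%N r @[n --> \oo] --> (qpoch q q r)^-1.
    by have := qbin_cvg (r := r); rewrite -(cvg_shiftn r).
  exact: (cvgM h (cvgM (cvg_cst _) (@qpoch_cvg _ _ q1 _))).
- rewrite -(qbinomial_sum q a x n).
  have -> : \sum_(r < n.+1) qbin q n r * (q ^+ 'C(r, 2) * (- x) ^+ r *
     qpoch a q r * qpoch (a * x * q ^+ r) q (n - r)) = \sum_(r < n.+1) u n r.
    by apply: eq_bigr => -[r /= rn] _; rewrite /u -ltnS rn.
  rewrite -big_fset_iota; apply: has_sum_finite => r.
  by rewrite in_fset mem_iota /= add0n ltnS /u => /negbTE ->.
Qed.

Lemma euler_sum x :
  has_sum (fun r : nat => (qpoch q q r)^-1 * (q ^+ 'C(r, 2) * (- x) ^+ r))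
    (qpoch_oo x q).
Proof.
apply: eq_has_sum (@one_phi_one 0 x) => r.
by rewrite !mul0r qpoch0l qpoch_oo0l // !mulr1.
Qed.

End OnePhiOne.

(** * Rational powers of the nome *)

Section Cexp.
Variable R : realType.

Lemma cexpD (z w : R[i]) : cexp (z + w) = cexp z * cexp w.
Proof.
case: z w => [a b] [c d]; rewrite /cexp /= expRD sinD cosD rmorphM /=.
rewrite mulrACA; congr (_ * _).
by apply/eqP; rewrite eq_complex /= eqxx /= [X in _ == X]addrC eqxx.
Qed.

Lemma cexp0 : cexp (0 : R[i]) = 1.
Proof. by rewrite /cexp /= expR0 cos0 sin0 mul1r. Qed.

Lemma cmod_cexp (z : R[i]) : cmod (cexp z) = expR (complex.Re z).
Proof.
rewrite /cexp cmodM /cmod !normc_def /= expr0n addr0 sqrtr_sqr.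
by rewrite cos2Dsin2 sqrtr1 mulr1 ger0_norm ?expR_ge0.
Qed.

End Cexp.

Section Qpow.
Variables (R : realType) (tau : R[i]).
Hypothesis tau_gt0 : 0 < complex.Im tau.
Local Notation q := (qpow tau).
Implicit Types a b r M : rat.

Lemma qpowD a b : q (a + b) = q a * q b.
Proof.
rewrite /qpow -cexpD; congr cexp.
have -> : ratr (a + b) = ratr a + ratr b :> R[i] by exact: rmorphD.
by ring.
Qed.

Lemma qpow0 : q 0 = 1.
Proof. by rewrite /qpow [ratr 0]rmorph0 mulr0 mul0r cexp0. Qed.

Lemma qpowX a n : q a ^+ n = q (n%:R * a).
Proof.
elim: n => [|n IH]; first by rewrite mul0r qpow0.
by rewrite exprS IH -qpowD -natr1 mulrDl mul1r addrC.
Qed.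

Lemma cmod_qpow r : cmod (q r) = expR (- (2 * pi * complex.Im tau * ratr r)).
Proof.
rewrite /qpow cmod_cexp; congr expR.
rewrite -(fmorph_rat (real_complex R)) /=; case: (tau) => x y.
have -> : (2 : R[i]) = (2 : R)%:C%C by rewrite rmorph_nat.
by rewrite /=; ring.
Qed.

Let c : R := 2 * pi * complex.Im tau.
Let c0 : 0 < c. Proof. by rewrite !mulr_gt0 // pi_gt0. Qed.

Lemma cmod_qpow_le a b : a <= b -> cmod (q b) <= cmod (q a).
Proof.
by move=> ab; rewrite !cmod_qpow ler_expR lerN2 -/c ler_pM2l // ler_rat.
Qed.

Lemma cmod_qpow_lt1 r : 0 < r -> cmod (q r) < 1.
Proof.
move=> r0; rewrite cmod_qpow -[ltRHS]expR0 ltr_expR oppr_lt0.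
by apply: mulr_gt0; [exact: c0|rewrite ltr0q].
Qed.

(* From here on only the functional equation of [qpow] is used. *)
#[local] Opaque qpow.

(** Reflection of a finite product: each factor 1 + q^(- e) is q^(- e) times
    1 + q^e, and the order of the factors is reversed. *)
Lemma qpoch_reflect b M n :
  q (b * n%:R + M * n%:R * (n%:R - 1) / 2)
    * qpoch (- q (M - b - M * n%:R)) (q M) n = qpoch (- q b) (q M) n.
Proof.
elim: n => [|n IH].
  by rewrite !mulr0 mul0r mul0r addr0 qpow0 !qpoch0 mulr1.
rewrite qpochSl qpochSr -IH mulNr -qpowD.
have -> : M - b - M * n.+1%:R + M = M - b - M * n%:R by rewrite -natr1; ring.
set X := M - b - M * n.+1%:R; set E := b * n.+1%:R + _.
set E' := b * n%:R + _; set P := qpoch _ _ _.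
have key : q E + q (E + X) = q E' + q (E' + (b + n%:R * M)).
  by rewrite [LHS]addrC /E /E' /X -(natr1 n); congr (q _ + q _); field.
have -> : q E * ((1 - - q X) * P) = (q E + q (E + X)) * P.
  by rewrite (qpowD E X); ring.
have -> : q E' * P * (1 - - q b * q M ^+ n)
    = (q E' + q (E' + (b + n%:R * M))) * P.
  by rewrite qpowX (qpowD E') (qpowD b); ring.
by rewrite key.
Qed.

Lemma bin2_rat k : ('C(k, 2))%:R = k%:R * (k%:R - 1) / 2 :> rat.
Proof.
elim: k => [|k IH]; first by rewrite !mul0r.
by rewrite binS bin1 natrD IH -natr1; field.
Qed.

(** By completing the square: any linear growth is below a quadratic one. *)
Lemma quadratic_lower_bound (A B : rat) : 0 < A ->
  exists K : rat, forall n : int, `|n|%N%:R <= A * n%:~R ^+ 2 + B * n%:~R + K.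
Proof.
move=> A0; exists ((`|B| + 1) ^+ 2 / (4 * A)) => n.
have -> : n%:~R ^+ 2 = (`|n|%N%:R : rat) ^+ 2.
  by rewrite natr_absz intr_norm real_normK // num_real.
have : - (`|B| * `|n|%N%:R) <= B * n%:~R.
  by rewrite natr_absz intr_norm -normrM lerNnormlW.
set t := `|n|%N%:R => Bt.
have h : 0 <= A * (t - (`|B| + 1) / (2 * A)) ^+ 2.
  by rewrite mulr_ge0 ?sqr_ge0 // ltW.
have e : A * (t - (`|B| + 1) / (2 * A)) ^+ 2 =
    A * t ^+ 2 - (`|B| + 1) * t + (`|B| + 1) ^+ 2 / (4 * A).
  by field; rewrite gt_eqF.
by rewrite e in h; lra.
Qed.

Lemma bounded_sums_theta (A B : rat) : 0 < A ->
  bounded_sums (fun n : int => cmod (q (A * n%:~R ^+ 2 + B * n%:~R))).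
Proof.
move=> A0; have [K hK] := quadratic_lower_bound B A0.
have q1 := cmod_qpow_lt1 ltr01.
apply: (@le_bounded_sums _ _
  (fun n : int => cmod (q (- K)) * cmod (q 1) ^+ `|n|%N)).
  move=> n; rewrite cmod_ge0 /= -cmodX qpowX -cmodM -qpowD.
  by apply: cmod_qpow_le; have := hK n; lra.
apply: bounded_sumsZ; first exact: cmod_ge0.
by apply: bounded_sums_geometric_int; rewrite cmod_ge0.
Qed.

(** Jacobi's triple product. It is the q-binomial theorem of order [2 n] with
    its summation index recentred at [n] and half of the product reflected; the
    coefficients tend to [1 / (Q; Q)_oo], since both lower indices go to
    infinity. *)
Lemma jacobi_triple_product (A B : rat) : 0 < A ->
  has_sum (fun n : int => q (A * n%:~R ^+ 2 + B * n%:~R))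
    (Jbar tau (A + B) (2 * A)).
Proof.
move=> A0; set Q := q (2 * A).
have Q1 : cmod Q < 1 by apply: cmod_qpow_lt1; lra.
have [C C0 hC] := cmod_qbin_le Q1.
pose f (n : int) := q (A * n%:~R ^+ 2 + B * n%:~R).
pose u (n : nat) (j : int) :=
  if (`|j| <= n)%N then qbin Q (n + n) `|(n%:Z + j)%R|%N * f j else 0.
have Q0 := qpoch_oo_neq0 Q1.
suff h : has_sum (fun j => (qpoch_oo Q Q)^-1 * f j)
    (qpoch_oo (- q (A + B)) Q * qpoch_oo (- q (A - B)) Q).
  have := @has_sumZ _ _ (qpoch_oo Q Q) _ _ h; rewrite mulrC /Jbar.
  have -> : 2 * A - (A + B) = A - B by ring.
  by apply: eq_has_sum => j; rewrite mulVKf.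
apply: (tannery (u := u) (bounded_sumsZ C0 (bounded_sums_theta B A0)) _ _ _
  (cvgM (@qpoch_cvg _ _ Q1 _) (@qpoch_cvg _ _ Q1 _))) => [n j|j|n].
- rewrite /u; case: ifP => _; last by rewrite cmod0 mulr_ge0 ?cmod_ge0.
  by rewrite cmodM ler_wpM2r ?cmod_ge0.
- have uE : \forall n \near \oo, qpoch Q Q n.*2 /
      (qpoch Q Q `|(n%:Z + j)%R|%N * qpoch Q Q `|(n%:Z + - j)%R|%N) * f j
      = u n j.
    exists `|j|%N => // n /= jn; rewrite /u jn -addnn qbinE //; last by lia.
    by congr (_ / (_ * qpoch Q Q _) * _); lia.
  apply: cvg_trans (near_eq_cvg uE) _.
  have -> : (qpoch_oo Q Q)^-1 = qpoch_oo Q Q / (qpoch_oo Q Q * qpoch_oo Q Q).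
    by rewrite invfM mulrA divff // mul1r.
  have h := @qpoch_cvg _ _ Q1 Q.
  have hV : (qpoch Q Q `|(n%:Z + j)%R|%N * qpoch Q Q `|(n%:Z + - j)%R|%N)^-1
      @[n --> \oo] --> (qpoch_oo Q Q * qpoch_oo Q Q)^-1.
    apply: (cvgV (mulf_neq0 Q0 Q0)).
    exact: (cvgM (@cvg_absz_addz _ _ _ j h) (@cvg_absz_addz _ _ _ (- j) h)).
  exact: (cvgM (cvgM (cvg_double h) hV) (cvg_cst (f j))).
- rewrite /=; set x := - q (2 * A - (A - B) - 2 * A * n%:R).
  have -> : qpoch (- q (A + B)) Q n * qpoch (- q (A - B)) Q n =
      q (A * n%:R ^+ 2 - B * n%:R) * qpoch x Q (n + n).
    rewrite qpochD -[qpoch (- q (A - B)) Q n]qpoch_reflect -/x.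
    have -> : x * Q ^+ n = - q (A + B).
      by rewrite qpowX mulNr -qpowD; congr (- q _); ring.
    have -> : (A - B) * n%:R + 2 * A * n%:R * (n%:R - 1) / 2 =
        A * n%:R ^+ 2 - B * n%:R by field.
    by ring.
  pose h (k : nat) := k%:Z - n%:Z.
  have hI : injective h by move=> k l; rewrite /h; lia.
  rewrite -(qbinomial_sum Q 0 x (n + n)) mulr_sumr.
  have -> : \sum_(r < (n + n).+1) q (A * n%:R ^+ 2 - B * n%:R)
      * (qbin Q (n + n) r * (Q ^+ 'C(r, 2) * (- x) ^+ r * qpoch 0 Q r
         * qpoch (0 * x * Q ^+ r) Q (n + n - r)))
     = \sum_(r < (n + n).+1) u n (h r).
    apply: eq_bigr => -[r /= rn] _; rewrite /u /h.
    have -> : (`|(r%:Z - n%:Z)%R| <= n)%N by lia.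
    have -> : `|(n%:Z + (r%:Z - n%:Z))%R|%N = r by lia.
    rewrite !mul0r !qpoch0l !mulr1 mulrCA; congr (_ * _).
    rewrite /x opprK !qpowX -!qpowD /f; congr (q _).
    by rewrite bin2_rat intrB; field.
  rewrite -(big_fset_iota (fun k : nat => u n (h k))).
  set S := [fset k in iota 0 (n + n).+1].
  have <- : \sum_(i <- [fset h k | k in S]) u n i = \sum_(k <- S) u n (h k).
    by rewrite big_imfset //= => k l _ _ /hI.
  apply: has_sum_finite => j jn; rewrite /u; case: ifP => // jn'.
  case/imfsetP: jn; exists `|(n%:Z + j)%R|%N => /=; last by rewrite /h; lia.
  by rewrite in_fset mem_iota /=; lia.
Qed.

End Qpow.

(** * Quasi-periodicity and special values of the theta products *)

Section ThetaProducts.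
Variables (R : realType) (tau : R[i]).
Hypothesis tau_gt0 : 0 < complex.Im tau.
Local Notation q := (qpow tau).
Local Notation J := (J tau).
Local Notation Jbar := (Jbar tau).
Implicit Types a M : rat.

Let q1 M : 0 < M -> cmod (q M) < 1. Proof. exact: cmod_qpow_lt1. Qed.

Lemma J_neq0 M : 0 < M -> J M != 0.
Proof. by move=> M0; apply: qpoch_oo_neq0; exact: q1. Qed.

Lemma Jbar_sym a M : Jbar (M - a) M = Jbar a M.
Proof. by rewrite /Defs.Jbar subKr [X in X * _]mulrC. Qed.

Lemma JbarD a M : 0 < M -> Jbar (a + M) M = q (- a) * Jbar a M.
Proof.
move=> M0; rewrite /Defs.Jbar.
have -> : M - (a + M) = - a by ring.
rewrite (qpoch_oo_shift (q1 M0) (- q a) 1).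
rewrite (qpoch_oo_shift (q1 M0) (- q (- a)) 1).
rewrite !qpochSr !qpoch0 !expr0 !expr1 !mulr1 !mul1r !mulNr -!qpowD !opprK.
rewrite [- a + M]addrC.
have -> : 1 + q (- a) = q (- a) * (1 + q a).
  by rewrite mulrDr mulr1 -qpowD addNr qpow0 addrC.
by ring.
Qed.

Lemma JbarN a M : 0 < M -> Jbar (- a) M = q (- a) * Jbar a M.
Proof. by move=> M0; rewrite -Jbar_sym opprK addrC JbarD. Qed.

Lemma JbarDn a M (n : nat) : 0 < M ->
  Jbar (a + M * n%:R) M =
    q (- (a * n%:R + M * n%:R * (n%:R - 1) / 2)) * Jbar a M.
Proof.
move=> M0; elim: n => [|n IH].
  by rewrite !mulr0 !mul0r !addr0 oppr0 qpow0 mul1r.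
have -> : a + M * n.+1%:R = a + M * n%:R + M by rewrite -(natr1 n); ring.
rewrite (JbarD _ M0) IH mulrA -qpowD; congr (q _ * _).
by rewrite -(natr1 n); field.
Qed.

Lemma JbarDz a M (n : int) : 0 < M ->
  Jbar (a + M * n%:~R) M =
    q (- (a * n%:~R + M * n%:~R * (n%:~R - 1) / 2)) * Jbar a M.
Proof.
move=> M0; case: n => n; first exact: JbarDn.
rewrite NegzE mulrNz; set b := a + _.
have ab : b + M * n.+1%:R = a by rewrite /b; ring.
have := JbarDn b n.+1 M0; rewrite ab => ->; rewrite mulrA -qpowD.
set e := (X in q X * _); have -> : e = 0 by rewrite /e /b; field.
by rewrite qpow0 mul1r.
Qed.

Lemma qpoch_oo_NJ M : 0 < M -> qpoch_oo (- q M) (q M) * J M = J (2 * M).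
Proof.
by move=> M0; rewrite mulrC (qpoch_oo_dup _ (q1 M0)) !qpowX.
Qed.

Lemma Jbar0 M : 0 < M -> Jbar 0 M * J M = 2 * J (2 * M) ^+ 2.
Proof.
move=> M0; rewrite /Defs.Jbar subr0 qpow0.
rewrite (qpoch_oo_shift (q1 M0) (- 1) 1) qpochSr qpoch0 !expr0 expr1.
rewrite mulr1 mul1r opprK mulN1r.
rewrite -(qpoch_oo_NJ M0) /Defs.J; ring.
Qed.

Lemma J_split M : 0 < M -> J M = qpoch_oo (q M) (q (2 * M)) * J (2 * M).
Proof.
by move=> M0; rewrite /Defs.J (qpoch_oo_split _ (q1 M0)) -expr2 !qpowX.
Qed.

(** The square of (- q^M; q^(2 M))_oo is removed by pairing each factor with one
    of (q^M; q^(2 M))_oo, which is the odd half of the product [J M]. *)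
Lemma Jbar_half M : 0 < M ->
  Jbar M (2 * M) * J M ^+ 2 * J (4 * M) ^+ 2 = J (2 * M) ^+ 5.
Proof.
move=> M0; have M20 : 0 < 2 * M by lra.
have M4E : 2 * (2 * M) = 4 * M by ring.
have dup : qpoch_oo (q M) (q (2 * M)) * qpoch_oo (- q M) (q (2 * M)) =
    qpoch_oo (q (2 * M)) (q (4 * M)).
  by rewrite (qpoch_oo_dup _ (q1 M20)) !qpowX M4E.
have J2M := J_split M20; rewrite M4E -dup in J2M.
rewrite /Defs.Jbar; have -> : 2 * M - M = M by ring.
rewrite -[qpoch_oo (q (2 * M)) (q (2 * M))]/(J (2 * M)) (J_split M0) J2M.
ring.
Qed.

Let int_of_parity (t : bool * int) : int := 2 * t.2 + t.1%:R.

Let int_of_parity_bij : bijective int_of_parity.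
Proof.
exists (fun n : int => (intdiv.modz n 2 != 0, intdiv.divz n 2)) => [[[] n]|n];
  rewrite /int_of_parity /=.
- by congr (_, _); lia.
- by congr (_, _); lia.
by case: eqP => /=; lia.
Qed.

(** By quasi-periodicity [Jbar (2 n) 4] is a power of the nome times [Jbar 0 4]
    for even [n] and times [Jbar 2 4] for odd [n]; the power lowers the
    coefficient of the square from [4 al] to [4 al - 2]. The factor [J 4 ^+ 2]
    comes from the values of these two constants. *)
Lemma theta_parity_sum (al be : rat) : 0 < 4 * al - 2 ->
  has_sum (fun n : int => q (al * n%:~R ^+ 2 + be * n%:~R) * Jbar (2 * n%:~R) 4)
    (J 4 ^+ 2 *
      (2 * (J 8 ^+ 2 * Jbar (4 * al + 2 * be) (2 * (4 * al - 2)) / J 4 ^+ 3)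
       + q (al + be) * (J 4 ^+ 3 * Jbar (8 * al + 2 * be - 2) (2 * (4 * al - 2))
          / (J 2 ^+ 2 * J 8 ^+ 2)))).
Proof.
move=> A0; have M4 : 0 < 4 :> rat by [].
have J2 : J 2 != 0 by exact: J_neq0.
have J4 : J 4 != 0 by exact: J_neq0.
have J8 : J 8 != 0 by exact: J_neq0.
set X := Jbar (4 * al + _) _; set Y := Jbar (8 * al + _ - _) _.
have -> : J 4 ^+ 2 * (2 * (J 8 ^+ 2 * X / J 4 ^+ 3)
       + q (al + be) * (J 4 ^+ 3 * Y / (J 2 ^+ 2 * J 8 ^+ 2)))
    = Jbar 0 4 * X + q (al + be) * Jbar 2 4 * Y.
  have := Jbar0 M4; have -> : 2 * 4 = 8 :> rat by [].
  move=> E0; have -> : Jbar 0 4 = 2 * J 8 ^+ 2 / J 4.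
    by apply: (canRL (mulfK J4)); exact: E0.
  have := Jbar_half (isT : 0 < 2 :> rat).
  have [-> ->] : 2 * 2 = 4 :> rat /\ 4 * 2 = 8 :> rat by [].
  move=> E2; have -> : Jbar 2 4 = J 4 ^+ 5 / (J 2 ^+ 2 * J 8 ^+ 2).
    have nz : J 2 ^+ 2 * J 8 ^+ 2 != 0.
      exact: mulf_neq0 (expf_neq0 2 J2) (expf_neq0 2 J8).
    by apply: (canRL (mulfK nz)); rewrite mulrA; exact: E2.
  move: (J 2) (J 4) (J 8) (q _) X Y J2 J4 J8 => a b c d x y a0 b0 c0.
  by field; rewrite a0 b0 c0.
apply: (has_sum_reindex int_of_parity_bij).
apply: has_sum_pair_bool.
- have := @has_sumZ _ _ (Jbar 0 4) _ _
    (@jacobi_triple_product _ _ tau_gt0 _ (2 * be + 2) A0).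
  have -> : 4 * al - 2 + (2 * be + 2) = 4 * al + 2 * be by ring.
  apply: eq_has_sum => n; rewrite /int_of_parity /=.
  have -> : (2 * n + 0)%:~R = 2 * n%:~R :> rat by rewrite addr0 intrM.
  have -> : 2 * (2 * n%:~R) = 0 + 4 * n%:~R :> rat by ring.
  by rewrite (JbarDz _ _ M4) [RHS]mulrA -qpowD mulrC; congr (q _ * _); field.
- have := @has_sumZ _ _ (q (al + be) * Jbar 2 4) _ _
    (@jacobi_triple_product _ _ tau_gt0 _ (4 * al + 2 * be) A0).
  have -> : 4 * al - 2 + (4 * al + 2 * be) = 8 * al + 2 * be - 2 by ring.
  apply: eq_has_sum => n; rewrite /int_of_parity /=.
  have -> : (2 * n + 1)%:~R = 2 * n%:~R + 1 :> rat by rewrite intrD intrM.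
  have -> : 2 * (2 * n%:~R + 1) = 2 + 4 * n%:~R :> rat by ring.
  by rewrite (JbarDz _ _ M4) mulrAC [RHS]mulrA -!qpowD; congr (q _ * _); field.
Qed.

End ThetaProducts.

(** * Reduction of the triple sum to a single sum *)

Section TripleSum.
Variables (R : realType) (tau : R[i]).
Hypothesis tau_gt0 : 0 < complex.Im tau.
Variables m nu c : rat.
Hypothesis m_gt0 : 0 < m.
Local Notation q := (qpow tau).
Local Notation Q := (qpow tau 4).

Definition triple_exponent (i j k : nat) : rat :=
  2 * m * (i%:R - j%:R) ^+ 2 + (i%:R + j%:R) ^+ 2 + 2 * k%:R ^+ 2
  - 2 * (i%:R + j%:R) * k%:R + nu * (i%:R - j%:R) + c * k%:R.

Definition triple_term (i j k : nat) : R[i] :=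
  q (triple_exponent i j k) / (qpoch Q Q i * qpoch Q Q j * qpoch Q Q k).

Definition single_term (n : int) : R[i] :=
  q ((2 * m + 1) * n%:~R ^+ 2 + nu * n%:~R) / Defs.J tau 4
  * (qpoch_oo (- q (2 + c - 2 * n%:~R)) Q
     * qpoch_oo (- q (2 + c + 2 * n%:~R)) Q).

Let Q1 : cmod Q < 1. Proof. exact: cmod_qpow_lt1. Qed.

(** The quadratic part is at least (i + j - k)^2 + k^2. Completing the squares
    at [u] and [v] turns it into a linear form whose coefficients exceed those
    of the linear terms by one. *)
Lemma triple_exponent_ge : exists K : rat, forall i j k : nat,
  i%:R + j%:R + k%:R - K <= triple_exponent i j k.
Proof.
pose u := (`|nu| + 1) / 2; pose v := (2 * u + `|c| + 1) / 2.
exists (u ^+ 2 + v ^+ 2) => i j k; rewrite /triple_exponent.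
move: (ler0n rat i) (ler0n rat j) (ler0n rat k).
set a := i%:R; set b := j%:R; set d := k%:R => a0 b0 d0.
have h1 : 0 <= 2 * m * (a - b) ^+ 2.
  by rewrite mulr_ge0 ?sqr_ge0 // mulr_ge0 // ltW.
have h2 : 0 <= (a + b - d - u) ^+ 2 by exact: sqr_ge0.
have h3 : 0 <= (d - v) ^+ 2 by exact: sqr_ge0.
have h4 : - (`|nu| * (a + b)) <= nu * (a - b).
  apply: le_trans (_ : - (`|nu| * `|a - b|) <= _).
    by rewrite lerN2 ler_wpM2l // ler_norml; apply/andP; split; lra.
  by rewrite -normrM lerNnormlW.
have h5 : - (`|c| * d) <= c * d.
  by rewrite -[X in `|_| * X](ger0_norm d0) -normrM lerNnormlW.
have e2 : (a + b - d - u) ^+ 2 = (a + b) ^+ 2 - 2 * (a + b) * d + d ^+ 2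
    - (`|nu| + 1) * (a + b) + (`|nu| + 1) * d + u ^+ 2 by rewrite /u; field.
have e3 : (d - v) ^+ 2 = d ^+ 2 - (`|nu| + `|c| + 2) * d + v ^+ 2.
  by rewrite /v /u; field.
rewrite e2 in h2; rewrite e3 in h3; lra.
Qed.

Lemma triple_term_has_sum :
  exists s, has_sum (fun t : nat * nat * nat => triple_term t.1.1 t.1.2 t.2) s.
Proof.
have [K hK] := triple_exponent_ge.
set B := expR ((1 - cmod Q)^-1 / (1 - cmod Q)); set w := cmod (q 1).
have w1 : 0 <= w < 1 by rewrite cmod_ge0 cmod_qpow_lt1.
pose C := cmod (q (- K)) * (B * B * B).
have C0 : 0 <= C by rewrite !mulr_ge0 ?cmod_ge0 ?expR_ge0.
have geo := bounded_sums_geometric w1.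
have bg := bounded_sumsZ C0 (bounded_sumsM (bounded_sumsM geo geo) geo).
apply: (dominated_has_sum bg) => -[[i j] k] /=.
have -> : C * (w ^+ i * w ^+ j * w ^+ k) =
    cmod (q (i%:R + j%:R + k%:R - K)) * (B * B * B).
  have qD a b : cmod (q (a + b)) = cmod (q a) * cmod (q b).
    by rewrite qpowD cmodM.
  have qn n : cmod (q n%:R) = w ^+ n by rewrite -cmodX qpowX mulr1.
  by rewrite (qD _ (- K)) (qD _ k%:R) (qD i%:R) (qn i) (qn j) (qn k) /C; ring.
rewrite /triple_term cmodM cmodV 2!cmodM !invfM.
have hB n : 0 <= (cmod (qpoch Q Q n))^-1 <= B.
  by rewrite invr_ge0 cmod_ge0 cmod_qpoch_inv_le.
have /andP[i0 iB] := hB i; have /andP[j0 jB] := hB j; have /andP[k0 kB] := hB k.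
apply: ler_pM; [exact: cmod_ge0|by rewrite !mulr_ge0|exact: cmod_qpow_le|].
by apply: ler_pM; [exact: mulr_ge0|exact: k0|exact: ler_pM|exact: kB].
Qed.

Lemma sum_over_k (i j : nat) :
  has_sum (fun k => triple_term i j k)
    (q (2 * m * (i%:R - j%:R) ^+ 2 + (i%:R + j%:R) ^+ 2 + nu * (i%:R - j%:R))
     / (qpoch Q Q i * qpoch Q Q j)
     * qpoch_oo (- q (2 + c - 2 * (i%:R + j%:R))) Q).
Proof.
set A := _ + nu * _; set b := 2 + c - _.
have := @has_sumZ _ _ (q A / (qpoch Q Q i * qpoch Q Q j)) _ _
  (@euler_sum _ _ Q1 (- q b)).
apply: eq_has_sum => k; rewrite opprK !qpowX /triple_term.
have -> : triple_exponent i j k = A + ('C(k, 2)%:R * 4 + k%:R * b).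
  by rewrite bin2_rat /triple_exponent /A /b; field.
rewrite (qpowD _ A) (qpowD _ ('C(k, 2)%:R * 4)) !invfM.
move: (q A) (q (_ * 4)) (q (_ * b)) => x y z.
move: (qpoch Q Q i)^-1 (qpoch Q Q j)^-1 (qpoch Q Q k)^-1 => *; ring.
Qed.

(** The double index [(i, j)] in the coordinates [i - j] and [min i j]. *)
Definition ij_of_diff (t : int * nat) : nat * nat :=
  if 0 <= t.1 then (t.2 + `|t.1|, t.2)%N else (t.2, t.2 + `|t.1|)%N.

Lemma ij_of_diff_bij : bijective ij_of_diff.
Proof.
exists (fun p : nat * nat => (p.1%:Z - p.2%:Z, minn p.1 p.2)) => [[n r]|[i j]].
  by rewrite /ij_of_diff /=; case: ifP => n0 /=; congr (_, _); lia.
by rewrite /ij_of_diff /=; case: ifP => n0 /=; congr (_, _); lia.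
Qed.

(** Raising [r] by one divides the base of Euler's product by [Q], that is, puts
    one more factor in front of it. The first [r] factors, reflected, form the
    product (a; Q)_r, and [a x = Q^(n + 1)] makes 1 / (Q; Q)_(r + n) the
    remaining factor of the series 1phi1. *)
Lemma sum_over_min (e : rat) (n : nat) :
  has_sum (fun r : nat => q (e + (n + r + r)%:R ^+ 2)
      / (qpoch Q Q (r + n) * qpoch Q Q r)
      * qpoch_oo (- q (2 + c - 2 * (n + r + r)%:R)) Q)
    (q (e + n%:R ^+ 2) / Defs.J tau 4
     * (qpoch_oo (- q (2 + c - 2 * n%:R)) Q
        * qpoch_oo (- q (2 + c + 2 * n%:R)) Q)).
Proof.
set a := - q (2 - c + 2 * n%:R); set x := - q (2 + c + 2 * n%:R).
set y := - q (2 + c - 2 * n%:R); rewrite mulrA.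
have := @has_sumZ _ _ (q (e + n%:R ^+ 2) / Defs.J tau 4 * qpoch_oo y Q) _ _
  (@one_phi_one _ _ Q1 a x).
apply: eq_has_sum => r.
have J4 : Defs.J tau 4 != 0 by exact: J_neq0.
have Qnr : qpoch Q Q (r + n) != 0 by exact: qpoch_neq0.
have -> : qpoch_oo (a * x * Q ^+ r) Q = Defs.J tau 4 / qpoch Q Q (r + n).
  have -> : a * x * Q ^+ r = Q * Q ^+ (r + n).
    rewrite /a /x mulrNN !qpowX -!qpowD natrD; congr (q _); ring.
  by apply: (canRL (mulfK Qnr)); rewrite mulrC -(qpoch_oo_shift Q1).
have -> : qpoch_oo (- q (2 + c - 2 * (n + r + r)%:R)) Q =
    qpoch (- q (2 + c - 2 * (n + r + r)%:R)) Q r * qpoch_oo y Q.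
  have <- : - q (2 + c - 2 * (n + r + r)%:R) * Q ^+ r = y.
    by rewrite /y mulNr qpowX -qpowD !natrD; congr (- q _); ring.
  exact: qpoch_oo_shift.
rewrite -(qpoch_reflect tau (2 - c + 2 * n%:R)).
have -> : 4 - (2 - c + 2 * n%:R) - 4 * r%:R = 2 + c - 2 * (n + r + r)%:R.
  by rewrite !natrD; ring.
rewrite /x opprK !qpowX.
set E1 := (2 - c + 2 * n%:R) * _ + _ / 2; set E2 := r%:R * (2 + c + _).
have -> : e + (n + r + r)%:R ^+ 2 =
    (e + n%:R ^+ 2) + ('C(r, 2)%:R * 4 + (E2 + E1)).
  by rewrite /E1 /E2 bin2_rat !natrD; field.
rewrite (qpowD _ (e + n%:R ^+ 2)) (qpowD _ ('C(r, 2)%:R * 4)) (qpowD _ E2).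
have Qr : qpoch Q Q r != 0 by exact: qpoch_neq0.
move: (qpoch (- _) Q r) (qpoch_oo y Q) => P T.
move: (q (e + _)) (q (_ * 4)) (q E1) (q E2) => z1 z2 z3 z4.
move: Qnr Qr J4.
move: (Defs.J tau 4) (qpoch Q Q (r + n)) (qpoch Q Q r) => u v w ? ? ?.
by field; apply/and3P.
Qed.

(** [sum_over_min] is used with [n] the absolute value of the difference
    [N = i - j]; its right-hand side is even in [n]. *)
Lemma triple_sum_eq_single_sum : exists s,
  has_sum (fun t : nat * nat * nat => triple_term t.1.1 t.1.2 t.2) s
  /\ has_sum single_term s.
Proof.
have [s hs] := triple_term_has_sum; exists s; split=> //.
have h2 := has_sum_iterated hs (fun p => @sum_over_k p.1 p.2).
have h3 := has_sum_bij ij_of_diff_bij h2.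
apply: (has_sum_iterated h3) => N.
set e := 2 * m * N%:~R ^+ 2 + nu * N%:~R.
have -> : single_term N = q (e + `|N|%N%:R ^+ 2) / Defs.J tau 4
    * (qpoch_oo (- q (2 + c - 2 * `|N|%N%:R)) Q
       * qpoch_oo (- q (2 + c + 2 * `|N|%N%:R)) Q).
  have -> : (`|N|%N%:R : rat) ^+ 2 = N%:~R ^+ 2.
    by rewrite natr_absz intr_norm real_normK // num_real.
  rewrite natr_absz intr_norm /single_term.
  have -> : (2 * m + 1) * N%:~R ^+ 2 + nu * N%:~R = e + N%:~R ^+ 2.
    by rewrite /e; ring.
  have [N0|N0] := leP 0 N; last first.
    have NN : N%:~R < 0 :> rat by rewrite ltrz0.
    by rewrite (ltr0_norm NN) mulrN opprK [X in _ * X = _]mulrC.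
  have NN : 0 <= N%:~R :> rat by rewrite ler0z.
  by rewrite (ger0_norm NN).
apply: eq_has_sum (@sum_over_min e `|N|%N) => r; rewrite /ij_of_diff /=.
have eE (x : rat) : e + x ^+ 2 = 2 * m * N%:~R ^+ 2 + x ^+ 2 + nu * N%:~R.
  by rewrite /e; ring.
case: ifP => N0 /=.
  have -> : (r + `|N|)%:R - r%:R = N%:~R :> rat.
    by rewrite natrD natr_absz ger0_norm //; ring.
  have -> : (r + `|N|)%:R + r%:R = (`|N| + r + r)%:R :> rat.
    by rewrite !natrD; ring.
  by rewrite eE.
have -> : r%:R - (r + `|N|)%:R = N%:~R :> rat.
  by rewrite natrD natr_absz ltr0_norm ?mulrNz; [ring|lia].
have -> : r%:R + (r + `|N|)%:R = (`|N| + r + r)%:R :> rat.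
  by rewrite !natrD; ring.
by rewrite eE [qpoch Q Q r * _]mulrC.
Qed.

End TripleSum.

(** * The three evaluations *)

Section Evaluations.
Variables (R : realType) (tau : R[i]).
Hypothesis tau_gt0 : 0 < complex.Im tau.
Variables m nu : rat.
Hypothesis m_gt0 : 0 < m.
Local Notation q := (qpow tau).
Local Notation Q := (qpow tau 4).
Local Notation J := (J tau).
Local Notation Jbar := (Jbar tau).
Local Notation qp a := (qpoch_oo (- q a) Q).
Local Notation al := (2 * m + 1).

Let Q1 : cmod Q < 1. Proof. exact: cmod_qpow_lt1. Qed.
Let J4 : J 4 != 0. Proof. exact: J_neq0. Qed.
Let A0 : 0 < 4 * al - 2. Proof. by move: m_gt0; lra. Qed.
Let J42 : J 4 ^+ 2 != 0. Proof. exact: expf_neq0 J4. Qed.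

Lemma Jbar4E a : Jbar a 4 = qp a * qp (4 - a) * J 4.
Proof. by []. Qed.

#[local] Opaque Defs.J Defs.Jbar qpoch_oo.

Lemma qp_step a : qp a = (1 + q a) * qp (a + 4).
Proof.
rewrite (qpoch_oo_shift Q1 (- q a) 1) qpochSr qpoch0 expr0 expr1.
by rewrite mulr1 mul1r opprK mulNr -qpowD.
Qed.

Lemma theta_parity_eq be s :
  has_sum (fun n : int => q (al * n%:~R ^+ 2 + be * n%:~R) * Jbar (2 * n%:~R) 4)
    (J 4 ^+ 2 * s) ->
  s = 2 * (J 8 ^+ 2 * Jbar (4 * al + 2 * be) (2 * (4 * al - 2)) / J 4 ^+ 3)
       + q (al + be) * (J 4 ^+ 3 * Jbar (8 * al + 2 * be - 2) (2 * (4 * al - 2))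
          / (J 2 ^+ 2 * J 8 ^+ 2)).
Proof.
move=> hs; apply: (mulfI J42).
exact: has_sum_unique hs (@theta_parity_sum _ _ tau_gt0 al be A0).
Qed.

(** The products of the summand at [n - 1] are those of [Jbar (2 n) 4]. *)
Lemma single_sum_c0 s : has_sum (single_term tau m nu 0) s ->
  s = J 4 ^+ 3 * Jbar (2 * (4 * m + nu + 1)) (4 * (4 * m + 1))
        / (J 2 ^+ 2 * J 8 ^+ 2)
      + 2 * q (2 * m + nu + 1)
        * (J 8 ^+ 2 * Jbar (- 2 * nu) (4 * (4 * m + 1)) / J 4 ^+ 3).
Proof.
pose e := al - nu; pose be := nu - 4 * m - 2.
have shift_bij : bijective (fun n : int => n - 1).
  by exists (fun n => n + 1) => n; rewrite ?addrK ?subrK.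
move=> /(has_sum_bij shift_bij) hs.
have /theta_parity_eq : has_sum (fun n : int =>
    q (al * n%:~R ^+ 2 + be * n%:~R) * Jbar (2 * n%:~R) 4)
    (J 4 ^+ 2 * (q (- e) * s)).
  rewrite mulrA.
  apply: eq_has_sum (@has_sumZ _ _ (J 4 ^+ 2 * q (- e)) _ _ hs) => n.
  rewrite /single_term Jbar4E intrB.
  have -> : 2 + 0 - 2 * (n%:~R - 1%:~R) = 4 - 2 * n%:~R :> rat by ring.
  have -> : 2 + 0 + 2 * (n%:~R - 1%:~R) = 2 * n%:~R :> rat by ring.
  have -> : al * n%:~R ^+ 2 + be * n%:~R =
     - e + (al * (n%:~R - 1%:~R) ^+ 2 + nu * (n%:~R - 1%:~R)).
    by rewrite /be /e; ring.
  rewrite (qpowD _ (- e)); move: (q (- e)) (q (_ + _)) (qp _) (qp _) => x y z t.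
  by move: J4; move: (J 4) => u u0; field.
have -> : 4 * al + 2 * be = 2 * nu by rewrite /be; ring.
have -> : 8 * al + 2 * be - 2 = 2 * (4 * m + nu + 1) by rewrite /be; ring.
have -> : 2 * (4 * al - 2) = 4 * (4 * m + 1) by ring.
have -> : al + be = - e by rewrite /e /be; ring.
have -> : Jbar (- 2 * nu) (4 * (4 * m + 1)) =
    q (- (2 * nu)) * Jbar (2 * nu) (4 * (4 * m + 1)).
  have M0 : 0 < 4 * (4 * m + 1) by move: m_gt0; lra.
  by rewrite mulNr (JbarN tau_gt0 _ M0).
have -> : q (2 * m + nu + 1) = q (2 * nu) * q e.
  by rewrite -qpowD /e; congr (q _); ring.
have qn : q (2 * nu) * q (- (2 * nu)) = 1 by rewrite -qpowD subrr qpow0.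
have qe : q e * q (- e) = 1 by rewrite -qpowD subrr qpow0.
have solve (u v x y a b d X Y : R[i]) : u * v = 1 -> x * y = 1 ->
    y * s = 2 * (d * X / a) + y * (a * Y / b) ->
    s = a * Y / b + 2 * (u * x) * (d * (v * X) / a).
  move=> uv xy h; have -> : s = x * (y * s) by rewrite mulrA xy mul1r.
  transitivity ((x * y) * (a * Y / b) + (u * v) * (2 * x * (d * X / a))).
    by rewrite h uv; ring.
  by rewrite xy; ring.
exact: solve qn qe.
Qed.

Let opp_bij : bijective (fun n : int => - n).
Proof. by exists (fun n => - n) => n; rewrite opprK. Qed.

(** With u = q^(2 n) and v = q^(- 2 n), the products of the summand at [n] have
    the factor (1 + u) (1 + v) = (1 + u) + (1 + v), as [u v = 1]. So the summand
    splits into the terms of [n] and [- n] of one theta series. *)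
Lemma single_sum_cN2 s : has_sum (single_term tau m 0 (-2)) s ->
  s = 4 * (J 8 ^+ 2 * Jbar (8 * m) (16 * m + 4) / J 4 ^+ 3)
       + 2 * q (2 * m - 1)
         * (J 4 ^+ 3 * Jbar 2 (16 * m + 4) / (J 2 ^+ 2 * J 8 ^+ 2)).
Proof.
move=> hs; have th := @theta_parity_sum _ _ tau_gt0 al 0 A0.
have M0 : 0 < 16 * m + 4 by move: m_gt0; lra.
have M1 : 2 * (4 * al - 2) = 16 * m + 4 by ring.
have X1 : 4 * al + 2 * 0 = 16 * m + 4 - 8 * m by ring.
have Y1 : 8 * al + 2 * 0 - 2 = 2 + (16 * m + 4) by ring.
rewrite M1 X1 Y1 Jbar_sym (JbarD tau_gt0 2 M0) in th.
move: th; set V := (X in has_sum _ (_ * X)) => th.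
have thN := has_sum_bij opp_bij th.
have -> : s = V + V.
  apply: (mulfI J42); rewrite mulrDr.
  apply: has_sum_unique _ (has_sumD th thN).
  apply: eq_has_sum (@has_sumZ _ _ (J 4 ^+ 2) _ _ hs) => n.
  rewrite /single_term !Jbar4E mulrNz sqrrN !mul0r !addr0 mulrN opprK.
  have -> : 2 - 2 - 2 * n%:~R = - (2 * n%:~R) :> rat by ring.
  have -> : 2 - 2 + 2 * n%:~R = 2 * n%:~R :> rat by ring.
  rewrite (qp_step (2 * n%:~R)) (qp_step (- (2 * n%:~R))).
  rewrite [2 * n%:~R + 4]addrC [- (2 * n%:~R) + 4]addrC.
  have : q (2 * n%:~R) * q (- (2 * n%:~R)) = 1 by rewrite -qpowD subrr qpow0.
  move: (q (al * _)) (q (2 * _)) (q (- _)) => x u v.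
  move: (qp (4 + _)) (qp (4 - _)) => a b uv; move: J4; move: (J 4) => j j0.
  transitivity (j * x * a * b * (1 + u + v + u * v)).
    by field.
  by rewrite uv; ring.
have -> : q (2 * m - 1) = q (al + 0) * q (- 2).
  by rewrite -qpowD; congr (q _); ring.
have twice (x v a b d X Y : R[i]) :
    (2 * (d * X / a) + x * (a * (v * Y) / b))
    + (2 * (d * X / a) + x * (a * (v * Y) / b))
    = 4 * (d * X / a) + 2 * (x * v) * (a * Y / b) by ring.
exact: twice.
Qed.

(** Only the sum of the terms of [n] and [- n] is a theta product; the series is
    thus evaluated twice. In the odd part [Jbar M M = Jbar 0 M] arises, which
    is a quotient of eta products. *)
Lemma single_sum_c2 s : has_sum (single_term tau m 1 2) s ->
  s = J 8 ^+ 2 * Jbar (8 * m + 2) (16 * m + 4) / J 4 ^+ 3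
       + q (2 * m)
         * (J 4 ^+ 3 * J (32 * m + 8) ^+ 2
            / (J 2 ^+ 2 * J 8 ^+ 2 * J (16 * m + 4))).
Proof.
move=> hs; have M0 : 0 < 16 * m + 4 by move: m_gt0; lra.
have J0 := J_neq0 tau_gt0 M0.
have hsN := has_sum_bij opp_bij hs.
have /theta_parity_eq : has_sum (fun n : int =>
    q (al * n%:~R ^+ 2 + (-1) * n%:~R) * Jbar (2 * n%:~R) 4)
    (J 4 ^+ 2 * (s + s)).
  apply: eq_has_sum (@has_sumZ _ _ (J 4 ^+ 2) _ _ (has_sumD hs hsN)) => n.
  rewrite /single_term Jbar4E mulrNz sqrrN !mul1r mulN1r mulrN opprK.
  have -> : 2 + 2 = 4 :> rat by [].
  rewrite (qp_step (2 * n%:~R)) [2 * n%:~R + 4]addrC !(qpowD _ (al * _)).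
  have -> : q (2 * n%:~R) = q n%:~R * q n%:~R.
    by rewrite -qpowD; congr (q _); ring.
  have : q n%:~R * q (- n%:~R) = 1 by rewrite -qpowD subrr qpow0.
  have fold (j x u v a b : R[i]) : j != 0 -> u * v = 1 ->
      j ^+ 2 * (x * u / j * (a * b) + x * v / j * (b * a)) =
      x * v * ((1 + u * u) * b * a * j).
    move=> j0 uv; transitivity (j * x * a * b * (v + u * (u * v))).
      by rewrite uv; field.
    by ring.
  exact: fold J4.
have -> : 2 * (4 * al - 2) = 16 * m + 4 by ring.
have -> : 4 * al + 2 * -1 = 8 * m + 2 by ring.
have -> : 8 * al + 2 * -1 - 2 = 16 * m + 4 - 0 by ring.
have -> : al + -1 = 2 * m by ring.
rewrite Jbar_sym => h.
have E := Jbar0 tau_gt0 M0.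
have M2 : 2 * (16 * m + 4) = 32 * m + 8 by ring.
rewrite M2 in E.
have E' : Jbar 0 (16 * m + 4) = 2 * J (32 * m + 8) ^+ 2 / J (16 * m + 4).
  by apply: (canRL (mulfK J0)); exact: E.
rewrite E' in h.
have halve (x a b d u X Y : R[i]) : s + s = 2 * X + x * (a * (2 * Y / u) / b) ->
    s = X + x * (a * Y / (b * u)).
  have two0 : (2 : R[i]) != 0 by rewrite pnatr_eq0.
  by move=> ss; apply: (mulfI two0); rewrite mulr_natl mulr2n ss invfM; ring.
exact: halve h.
Qed.

End Evaluations.

Section Conclusion.
Variables (R : realType) (tau : R[i]).
Hypothesis tau_gt0 : 0 < complex.Im tau.

Lemma triple_has_sum (m nu c : rat) (S : R[i]) (f : nat -> nat -> nat -> R[i]) :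
  0 < m -> (forall i j k, triple_term tau m nu c i j k = f i j k) ->
  (forall s, has_sum (single_term tau m nu c) s -> s = S) -> has_sum3 f S.
Proof.
move=> m0 tf sS.
have [s [ht /sS <-]] := triple_sum_eq_single_sum tau_gt0 nu c m0.
by apply: eq_has_sum ht => t; exact: tf.
Qed.

End Conclusion.

Theorem theorem3p1 (R : realType) (m nu : rat) (hm : 0 < m)
    (tau : R[i]) (htau : 0 < complex.Im tau) :
  let q := qpow tau in
  let J := J tau in
  let Jbar := Jbar tau in
  [/\ has_sum3 (fun i j k : nat =>
        q (2 * m * (i%:R - j%:R) ^+ 2 + (i%:R + j%:R) ^+ 2 + 2 * k%:R ^+ 2
           - 2 * (i%:R + j%:R) * k%:R + nu * (i%:R - j%:R))
        / (qpoch (q 4) (q 4) i * qpoch (q 4) (q 4) j * qpoch (q 4) (q 4) k))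
      (J 4 ^+ 3 * Jbar (2 * (4 * m + nu + 1)) (4 * (4 * m + 1))
         / (J 2 ^+ 2 * J 8 ^+ 2)
       + 2 * q (2 * m + nu + 1)
         * (J 8 ^+ 2 * Jbar (- 2 * nu) (4 * (4 * m + 1)) / J 4 ^+ 3)),
      has_sum3 (fun i j k : nat =>
        q (2 * m * (i%:R - j%:R) ^+ 2 + (i%:R + j%:R) ^+ 2 + 2 * k%:R ^+ 2
           - 2 * (i%:R + j%:R) * k%:R - 2 * k%:R)
        / (qpoch (q 4) (q 4) i * qpoch (q 4) (q 4) j * qpoch (q 4) (q 4) k))
      (4 * (J 8 ^+ 2 * Jbar (8 * m) (16 * m + 4) / J 4 ^+ 3)
       + 2 * q (2 * m - 1)
         * (J 4 ^+ 3 * Jbar 2 (16 * m + 4) / (J 2 ^+ 2 * J 8 ^+ 2)))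
    & has_sum3 (fun i j k : nat =>
        q (2 * m * (i%:R - j%:R) ^+ 2 + (i%:R + j%:R) ^+ 2 + 2 * k%:R ^+ 2
           - 2 * (i%:R + j%:R) * k%:R + i%:R - j%:R + 2 * k%:R)
        / (qpoch (q 4) (q 4) i * qpoch (q 4) (q 4) j * qpoch (q 4) (q 4) k))
      (J 8 ^+ 2 * Jbar (8 * m + 2) (16 * m + 4) / J 4 ^+ 3
       + q (2 * m)
         * (J 4 ^+ 3 * J (32 * m + 8) ^+ 2
            / (J 2 ^+ 2 * J 8 ^+ 2 * J (16 * m + 4))))].
Proof.
split.
- apply: (triple_has_sum htau hm (nu := nu) (c := 0)) => [i j k|s hs].
    rewrite /triple_term; congr (qpow _ _ / _).
    by rewrite /triple_exponent; ring.
  exact: single_sum_c0.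
- apply: (triple_has_sum htau hm (nu := 0) (c := -2)) => [i j k|s hs].
    rewrite /triple_term; congr (qpow _ _ / _).
    by rewrite /triple_exponent; ring.
  exact: single_sum_cN2.
- apply: (triple_has_sum htau hm (nu := 1) (c := 2)) => [i j k|s hs].
    rewrite /triple_term; congr (qpow _ _ / _).
    by rewrite /triple_exponent; ring.
  exact: single_sum_c2.
Qed.
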